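(* Let $W_n$ be the Coxeter group of type $B_n$ with $S=\{s_0,\dots,s_{n-1}\}$. The assignment $\partial_i^J\mapsto\partial_{\mathtt a_i^J}$ (and the identification of sequences with subsets $J\subset S$ on objects) defines an isomorphism of $\mathbb Z$-linear categories (algebroids) $$\psi\colon\mathrm{LNC}_B(n)\xrightarrow{\ \sim\ }\mathcal{AD}(W_n,S)$$ from the labeled nilCoxeter algebroid of type $B$ to the atomic subcategory $\mathcal{AD}(W_n,S)$ of the nilCoxeter algebroid of double cosets $\mathcal D(W_n,S)$.
   Context: $W=W_n$ has simple reflections $s_0,\dots,s_{n-1}$ with $m_{s_0s_1}=4$, $m_{s_is_{i+1}}=3$ for $i\ge1$, other pairs commuting; length $\ell$. It acts by permutations $\sigma$ of $X=\{-n,\dots,n\}$ with $\sigma(-i)=-\sigma(i)$, $s_0=(-1\ 1)$, $s_i=(i\ i{+}1)(-i\ {-i}{-}1)$. For $I\subset S$, $W_I$ is the parabolic subgroup, $w_I$ its longest element, $\ell(I)=\ell(w_I)$. An $(I,J)$-coset is an element $p\in W_I\backslash W/W_J$ (with $(I,J)$ part of the data), with Bruhat-maximal element $\overline p$. Let $*$ be the $0$-Hecke (star) product on $W$ ($s*w=sw$ if $\ell(sw)>\ell(w)$, else $s*w=w$). For an $(I,J)$-coset $p$ and a $(J,K)$-coset $q$, $p*q=W_I(\overline p*\overline q)W_K$; it is reduced if $\overline p*\overline q=(\overline pw_J^{-1})\overline q$ with $\ell(\overline p*\overline q)=\ell(\overline p)-\ell(J)+\ell(\overline q)$. $\mathcal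 D(W,S)$ is the $\mathbb Z$-linear category whose objects are the subsets of $S$, with $\mathrm{Hom}(J,I)$ the free $\mathbb Z$-module with basis $\{\partial_p\}$ over $(I,J)$-cosets $p$, and $\partial_p\circ\partial_q=\partial_{p*q}$ if $p*q$ is reduced, $\partial_p\circ\partial_q=0$ otherwise. Atomic cosets: for $J\subset S$ write $S\setminus J=\{s_{d_0},\dots,s_{d_{k-1}}\}$ with $d_0<\dots<d_{k-1}$. For $s=s_{d_i}$, $M=J\cup\{s\}$, $t=w_Msw_M$, let $\mathtt a_i^J$ be the $(M\setminus\{t\},J)$-coset containing $w_M$; these are the atomic cosets. $\mathcal{AD}(W,S)$ is the (non-full) $\mathbb Z$-linear subcategory of $\mathcal D(W,S)$ with all objects, generated by $\partial_p$ for $p$ atomic. $\mathrm{LNC}_B(n)$, $n\ge0$, is the $\mathbb Z$-linear category presented as follows. Objects are the sequences $(n_0,n_1,\dots,n_k)$ of positive integers (with $k\ge 0$ varying) with $\sum n_c=n+1$. These are identified with subsets $J\subset S$: $J$ corresponds to the sizes, in order, of the classes of the equivalence relation on $\{0,1,\dots,n\}$ generated by $j\sim j+1$ whenever $s_j\in J$ (so $n_0$ is the size of the class of $0$). Generating morphisms are $\partial_i^J$ for $0\le i\le k-1$: for $i>0$, $\partial_i^J$ goes from $J\leftrightarrow(n_0,n_1,\dots,n_i,n_{i+1},\dots,n_k)$ to $(n_0,n_1,\dots,n_{i+1},n_i,\dots,n_k)$, while $\partial_0^J$ goes from $J$ to itself. The relations, for every $J$ (whenever the generators involved exist; omitted superscripts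 being the unique ones making compositions well defined), are $\partial_0\partial_1\partial_0\partial_1^J=\partial_1\partial_0\partial_1\partial_0^J$; $\partial_i\partial_{i+1}\partial_i^J=\partial_{i+1}\partial_i\partial_{i+1}^J$ for $1\le i\le k-2$; $\partial_i\partial_j^J=\partial_j\partial_i^J$ for $|i-j|>1$; and $\partial_i\partial_i^J=0$ for $0\le i\le k-1$. *)

(* Defs.v *)
From HB Require Import structures.
From mathcomp Require Import all_boot all_algebra all_fingroup.
From mathcomp Require Import boolp.

Set Implicit Arguments.
Unset Strict Implicit.
Unset Printing Implicit Defensive.

Import GRing.Theory.

Local Open Scope quotient_scope.
Local Open Scope ring_scope.

(** * Z-linear categories *)

(* The data of a Z-linear category; the laws are in [is_lincat]. *)
Record lincat := LinCat {
  ob :> Type;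
  hom : ob -> ob -> zmodType;
  idm : forall x, hom x x;
  comp : forall x y z, hom y z -> hom x y -> hom x z
}.
Arguments hom {l} : rename.
Arguments idm {l} x : rename.
Arguments comp {l x y z} : rename.

Record is_lincat (C : lincat) : Prop := IsLinCat {
  lincat_compA : forall (w x y z : C) (f : hom y z) (g : hom x y) (h : hom w x),
    comp f (comp g h) = comp (comp f g) h;
  lincat_comp1m : forall (x y : C) (f : hom x y), comp (idm y) f = f;
  lincat_compm1 : forall (x y : C) (f : hom x y), comp f (idm x) = f;
  lincat_compDl : forall (x y z : C) (f g : hom y z) (h : hom x y),
    comp (f + g) h = comp f h + comp g h;
  lincat_compDr : forall (x y z : C) (f : hom y z) (g h : hom x y),
    comp f (g + h) = comp f g + comp f h
}.

Record linfunctor (C D : lincat) := LinFunctor {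
  fob :> C -> D;
  fmap : forall x y : C, hom x y -> hom (fob x) (fob y);
  fmapD : forall (x y : C) (f g : hom x y), fmap (f + g) = fmap f + fmap g;
  fmap1 : forall x : C, fmap (idm x) = idm (fob x);
  fmapM : forall (x y z : C) (f : hom y z) (g : hom x y),
    fmap (comp f g) = comp (fmap f) (fmap g)
}.
Arguments fmap {C D} l {x y} : rename.

(* The collection of all morphisms of C, each with its source and target. *)
Definition arrow (C : lincat) : Type := {x : C & {y : C & hom x y}}.

Definition Arrow (C : lincat) (x y : C) (f : hom x y) : arrow C :=
  existT (fun x : C => {y : C & hom x y}) x (existT (fun y : C => hom x y) y f).

Definition arrow_map (C D : lincat) (F : linfunctor C D) (a : arrow C) :
    arrow D :=
  Arrow (fmap F (projT2 (projT2 a))).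

(* F has a two-sided inverse functor. The equalities of functors are stated on
   objects and on [arrow]s, which avoids transporting morphisms along equalities
   of objects. *)
Definition is_lincat_iso (C D : lincat) (F : linfunctor C D) : Prop :=
  [/\ is_lincat C, is_lincat D &
   exists G : linfunctor D C,
     [/\ cancel F G, cancel G F,
         cancel (arrow_map F) (arrow_map G) &
         cancel (arrow_map G) (arrow_map F)]].

(** * The Z-linear subcategory with all objects generated by given morphisms *)

Section Subcategory.
Variables (C : lincat) (G : forall x y : C, hom x y -> Prop).

Inductive generated : forall x y : C, hom x y -> Prop :=
| gen_in x y (f : hom x y) : G f -> generated f
| gen_idm x : generated (idm x)
| gen_comp x y z (f : hom y z) (g : hom x y) :
    generated f -> generated g -> generated (comp f g)
| gen_zero x y : generated (0 : hom x y)
| gen_sub x y (f g : hom x y) : generated f -> generated g -> generated (f - g).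

Section Hom.
Variables x y : C.

Definition in_sub : {pred hom x y} := [pred f | `[< generated f >]].

Lemma in_sub_zmod : zmod_closed in_sub.
Proof.
split; first by apply/asboolP; apply: gen_zero.
by move=> f g /asboolP Hf /asboolP Hg; apply/asboolP; apply: gen_sub.
Qed.

HB.instance Definition _ := GRing.isZmodClosed.Build _ in_sub in_sub_zmod.

Record subhom := SubHom { subval :> hom x y; subvalP : subval \in in_sub }.
HB.instance Definition _ := [isSub for subval].
HB.instance Definition _ := [Choice of subhom by <:].
HB.instance Definition _ := [SubChoice_isSubZmodule of subhom by <:].
End Hom.

Definition sub_idm (x : C) : subhom x x := SubHom (asboolT (gen_idm x)).

Definition sub_comp (x y z : C) (f : subhom y z) (g : subhom x y) :
    subhom x z :=
  SubHom (asboolT (gen_comp (asboolW (subvalP f)) (asboolW (subvalP g)))).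

Definition subcat : lincat :=
  @LinCat C (fun x y => subhom x y) sub_idm sub_comp.

End Subcategory.

(** * Z-linear categories presented by generators and relations *)

Section Terms.
Variables (O : Type) (gen : O -> O -> Type).

Inductive term : O -> O -> Type :=
| TGen x y : gen x y -> term x y
| TId x : term x x
| TComp x y z : term y z -> term x y -> term x z
| TZero x y : term x y
| TAdd x y : term x y -> term x y -> term x y
| TOpp x y : term x y -> term x y.

HB.instance Definition _ x y := gen_eqMixin (term x y).
HB.instance Definition _ x y := gen_choiceMixin (term x y).
End Terms.

Arguments TGen {O gen x y}.
Arguments TId {O gen}.
Arguments TComp {O gen x y z}.
Arguments TZero {O gen}.
Arguments TAdd {O gen x y}.
Arguments TOpp {O gen x y}.

Section Presented.
Variables (O : Type) (gen : O -> O -> Type).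
Variable rel : forall x y, term gen x y -> term gen x y -> Prop.

(* The least congruence containing rel and the axioms of Z-linear categories. *)
Inductive cong : forall x y, term gen x y -> term gen x y -> Prop :=
| cong_rel x y (t u : term gen x y) : rel t u -> cong t u
| cong_refl x y (t : term gen x y) : cong t t
| cong_sym x y (t u : term gen x y) : cong t u -> cong u t
| cong_trans x y (t u v : term gen x y) : cong t u -> cong u v -> cong t v
| cong_comp x y z (t t' : term gen y z) (u u' : term gen x y) :
    cong t t' -> cong u u' -> cong (TComp t u) (TComp t' u')
| cong_add x y (t t' u u' : term gen x y) :
    cong t t' -> cong u u' -> cong (TAdd t u) (TAdd t' u')
| cong_opp x y (t t' : term gen x y) : cong t t' -> cong (TOpp t) (TOpp t')
| cong_addA x y (t u v : term gen x y) :
    cong (TAdd t (TAdd u v)) (TAdd (TAdd t u) v)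
| cong_addC x y (t u : term gen x y) : cong (TAdd t u) (TAdd u t)
| cong_add0 x y (t : term gen x y) : cong (TAdd (TZero x y) t) t
| cong_addN x y (t : term gen x y) : cong (TAdd (TOpp t) t) (TZero x y)
| cong_compA w x y z (t : term gen y z) (u : term gen x y) (v : term gen w x) :
    cong (TComp t (TComp u v)) (TComp (TComp t u) v)
| cong_comp1m x y (t : term gen x y) : cong (TComp (TId y) t) t
| cong_compm1 x y (t : term gen x y) : cong (TComp t (TId x)) t
| cong_compDl x y z (t u : term gen y z) (v : term gen x y) :
    cong (TComp (TAdd t u) v) (TAdd (TComp t v) (TComp u v))
| cong_compDr x y z (t : term gen y z) (u v : term gen x y) :
    cong (TComp t (TAdd u v)) (TAdd (TComp t u) (TComp t v)).

Section Hom.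
Variables x y : O.

Definition congb (t u : term gen x y) : bool := `[< cong t u >].

Lemma congb_refl : reflexive congb.
Proof. by move=> t; apply/asboolP; apply: cong_refl. Qed.

Lemma congb_sym : symmetric congb.
Proof. by move=> t u; apply: asbool_equiv_eq; split; apply: cong_sym. Qed.

Lemma congb_trans : transitive congb.
Proof.
move=> u t v /asboolP Htu /asboolP Huv.
by apply/asboolP; apply: cong_trans Htu Huv.
Qed.

Definition cong_equiv : equiv_rel (term gen x y) :=
  EquivRel congb congb_refl congb_sym congb_trans.

Definition preshom : Type := {eq_quot cong_equiv}.
HB.instance Definition _ := Choice.on preshom.

Definition cls (t : term gen x y) : preshom := \pi_({eq_quot cong_equiv}) t.
Definition rep (f : preshom) : term gen x y := generic_quotient.repr f.

Lemma repK : cancel rep cls.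
Proof. by move=> f; rewrite /cls /rep reprK. Qed.

Lemma clsP (t u : term gen x y) : cls t = cls u <-> cong t u.
Proof.
split=> [/eqquotP /asboolP //|H].
by apply/eqquotP; apply/asboolP.
Qed.

Lemma cong_rep (t : term gen x y) : cong (rep (cls t)) t.
Proof. by apply/clsP; rewrite repK. Qed.

Definition pres_zero : preshom := cls (TZero x y).
Definition pres_add (f g : preshom) : preshom := cls (TAdd (rep f) (rep g)).
Definition pres_opp (f : preshom) : preshom := cls (TOpp (rep f)).

Lemma cls_add (t u : term gen x y) : pres_add (cls t) (cls u) = cls (TAdd t u).
Proof. by apply/clsP; apply: cong_add; apply: cong_rep. Qed.

Lemma cls_opp (t : term gen x y) : pres_opp (cls t) = cls (TOpp t).
Proof. by apply/clsP; apply: cong_opp; apply: cong_rep. Qed.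

Lemma pres_addA : associative pres_add.
Proof.
move=> f g h; rewrite -(repK f) -(repK g) -(repK h) !cls_add.
by apply/clsP; apply: cong_addA.
Qed.

Lemma pres_addC : commutative pres_add.
Proof. by move=> f g; apply/clsP; apply: cong_addC. Qed.

Lemma pres_add0 : left_id pres_zero pres_add.
Proof. by move=> f; rewrite -(repK f) cls_add; apply/clsP; apply: cong_add0. Qed.

Lemma pres_addN : left_inverse pres_zero pres_opp pres_add.
Proof.
by move=> f; rewrite -(repK f) cls_opp cls_add; apply/clsP; apply: cong_addN.
Qed.

HB.instance Definition _ :=
  GRing.isZmodule.Build preshom pres_addA pres_addC pres_add0 pres_addN.

Lemma addcls (t u : term gen x y) : cls t + cls u = cls (TAdd t u).
Proof. exact: cls_add. Qed.
End Hom.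

Definition pres_comp (x y z : O) (f : preshom y z) (g : preshom x y) :
    preshom x z :=
  cls (TComp (rep f) (rep g)).

Lemma cls_comp (x y z : O) (t : term gen y z) (u : term gen x y) :
  pres_comp (cls t) (cls u) = cls (TComp t u).
Proof. by apply/clsP; apply: cong_comp; apply: cong_rep. Qed.

Definition presented : lincat :=
  @LinCat O (fun x y => preshom x y) (fun x => cls (TId x)) pres_comp.

Definition pgen (x y : O) (g : gen x y) : @hom presented x y := cls (TGen g).

Lemma presented_is_lincat : is_lincat presented.
Proof.
split=> /=.
- move=> w x y z f g h; rewrite -(repK f) -(repK g) -(repK h) !cls_comp.
  by apply/clsP; apply: cong_compA.
- move=> x y f; rewrite -(repK f) cls_comp.
  by apply/clsP; apply: cong_comp1m.
- move=> x y f; rewrite -(repK f) cls_comp.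
  by apply/clsP; apply: cong_compm1.
- move=> x y z f g h; rewrite -(repK f) -(repK g) -(repK h).
  by rewrite addcls !cls_comp addcls; apply/clsP; apply: cong_compDl.
- move=> x y z f g h; rewrite -(repK f) -(repK g) -(repK h).
  by rewrite addcls !cls_comp addcls; apply/clsP; apply: cong_compDr.
Qed.

End Presented.

(** * Double cosets in a finite Coxeter group *)

(* gT is a finite group generated by simple reflections s 0, ..., s (n - 1);
   subsets of S are given as sets of indices. *)
Section DoubleCosets.
Variables (gT : finGroupType) (n : nat) (s : 'I_n -> gT).
Local Open Scope group_scope.

Definition wprod (t : seq 'I_n) : gT := \prod_(i <- t) s i.

(* The least k such that w is a product of k simple reflections. The search may
   stop at #|gT| because the prefixes of a shortest word are distinct. *)
Definition len (w : gT) : nat :=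
  find (fun k => [exists t : k.-tuple 'I_n, wprod t == w]) (iota 0 #|gT|).

Definition reflections : {set gT} := [set s i ^ w | i : 'I_n, w : gT].

Definition bruhat : rel gT :=
  connect (fun u v => (u^-1 * v \in reflections) && (len u < len v)%N).

Definition parab (I : {set 'I_n}) : {group gT} := <<[set s i | i in I]>>%G.

Definition longest (I : {set 'I_n}) : gT :=
  [arg max_(w > 1%g in parab I) len w]%N.

Definition redword (w : gT) : seq 'I_n :=
  if [pick t : (len w).-tuple 'I_n | wprod t == w] is Some t then tval t
  else [::].

Definition star1 (i : 'I_n) (w : gT) : gT :=
  if (len w < len (s i * w)%g)%N then s i * w else w.

(* The 0-Hecke product: the associative product with [star (s i) = star1 i]. *)
Definition star (x y : gT) : gT := foldr star1 y (redword x).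

Section Cosets.
Variables I J : {set 'I_n}.

Definition dcosets : {set {set gT}} :=
  [set parab I :* w * parab J | w in [set: gT]].

Record dcos := DCos { dcval :> {set gT}; dcvalP : dcval \in dcosets }.
HB.instance Definition _ := [isSub for dcval].
HB.instance Definition _ := [Finite of dcos by <:].

Definition dcos_of (w : gT) : dcos := DCos (imset_f _ (in_setT w)).

Definition dcmax (p : dcos) : gT :=
  odflt 1 [pick w in dcval p | [forall x in dcval p, bruhat x w]].
End Cosets.

Definition dcstar I J K (p : dcos I J) (q : dcos J K) : dcos I K :=
  dcos_of I K (star (dcmax p) (dcmax q)).

Definition reduced I J K (p : dcos I J) (q : dcos J K) : bool :=
  let m := star (dcmax p) (dcmax q) in
  (m == dcmax p * (longest J)^-1 * dcmax q) &&
  (len m + len (longest J) == len (dcmax p) + len (dcmax q))%N.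

(* Hom(J, I) is the free Z-module on the (I, J)-cosets. *)
Definition dhom (J I : {set 'I_n}) : zmodType := {ffun dcos I J -> int}.

Definition dbasis I J (p : dcos I J) : dhom J I := [ffun q => (q == p)%:R%R].

Definition dcomp K J I (f : dhom J I) (g : dhom K J) : dhom K I :=
  (\sum_(p : dcos I J) \sum_(q : dcos J K | reduced p q)
     dbasis (dcstar p q) *~ (f p * g q))%R.

Definition Dcat : lincat :=
  @LinCat {set 'I_n} dhom (fun I => dbasis (dcos_of I I 1)) dcomp.

(* The atomic coset a_i^J. Since [enum] lists ordinals in increasing order,
   [enum_val i] is the index d_i of the i-th element of S \ J. *)
Section Atomic.
Variables (J : {set 'I_n}) (i : 'I_#|~: J|).

Definition atop : {set 'I_n} := enum_val i |: J.

Definition atarget : {set 'I_n} :=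
  [set j in atop | s j != longest atop * s (enum_val i) * longest atop].

Definition atomic_coset : dcos atarget J := dcos_of atarget J (longest atop).

Definition atomic : @hom Dcat J atarget := dbasis atomic_coset.
End Atomic.

Inductive is_atomic : forall J I : Dcat, hom J I -> Prop :=
  IsAtomic J (i : 'I_#|~: J|) : is_atomic (atomic i).

Definition ADcat : lincat := subcat is_atomic.

End DoubleCosets.

(** * The Coxeter group of type B_n *)

(* The ordinal j of 'I_(2n+1) stands for the integer j - n in {-n, ..., n}. *)
Definition posX (n j : nat) : 'I_(n.*2.+1) := inord (n + j).
Definition negX (n j : nat) : 'I_(n.*2.+1) := inord (n - j).

Definition signed_refl (n : nat) (i : 'I_n) : {perm 'I_(n.*2.+1)} :=
  if i == 0%N :> nat then tperm (negX n 1) (posX n 1)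
  else (tperm (posX n i) (posX n i.+1) * tperm (negX n i) (negX n i.+1))%g.

(* W_n as the group of signed permutations generated by the s_i. Permutations
   are composed from left to right here, so w acts on {-n, ..., n} on the left as
   the permutation w^-1; this fixes every s_i, so the pair (W, S) is the same. *)
Definition WBgroup (n : nat) : {group {perm 'I_(n.*2.+1)}} :=
  <<[set signed_refl i | i : 'I_n]>>%G.

Definition WB (n : nat) : finGroupType := subg_of (WBgroup n).

Lemma signed_refl_in (n : nat) (i : 'I_n) : signed_refl i \in WBgroup n.
Proof. by rewrite mem_gen // imset_f. Qed.

Definition sB (n : nat) (i : 'I_n) : WB n := Subg (signed_refl_in i).

(** * The labeled nilCoxeter algebroid of type B *)

Section LNCB.
Variable n : nat.

Record lncob := LncOb {
  parts :> seq nat;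
  partsP : all (ltn 0) parts && (sumn parts == n.+1)%N
}.

Definition swap_parts (i : nat) (c : seq nat) : seq nat :=
  if i == 0%N then c
  else take i c ++ [:: nth 0%N c i.+1; nth 0%N c i] ++ drop i.+2 c.

(* With c = (n_0, ..., n_k), the index of a generator ranges over i < k. *)
Record lncgen (c d : lncob) := LncGen {
  gidx : 'I_(size c).-1;
  gidxP : parts d == swap_parts gidx c
}.

(* [is_word [:: i; j; ...; l] t] says that t is the composite of generators
   with indices i, j, ..., l, the generator with index l being applied first. *)
Inductive is_word : seq nat -> forall c d : lncob, term lncgen c d -> Prop :=
| is_word1 c d (g : lncgen c d) : is_word [:: gidx g : nat] (TGen g)
| is_wordS c d e (g : lncgen d e) (r : seq nat) (t : term lncgen c d) :
    is_word r t -> is_word ((gidx g : nat) :: r) (TComp (TGen g) t).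

Inductive lncrel : forall c d : lncob,
    term lncgen c d -> term lncgen c d -> Prop :=
| lnc_braid4 c d (t u : term lncgen c d) :
    is_word [:: 0; 1; 0; 1]%N t -> is_word [:: 1; 0; 1; 0]%N u -> lncrel t u
| lnc_braid3 c d (t u : term lncgen c d) (i : nat) :
    (0 < i)%N -> is_word [:: i; i.+1; i] t -> is_word [:: i.+1; i; i.+1] u ->
    lncrel t u
| lnc_comm c d (t u : term lncgen c d) (i j : nat) :
    (i.+1 < j)%N || (j.+1 < i)%N -> is_word [:: i; j] t ->
    is_word [:: j; i] u -> lncrel t u
| lnc_nil c d (t : term lncgen c d) (i : nat) :
    is_word [:: i; i] t -> lncrel t (TZero c d).

Definition LNCB : lincat := presented lncrel.

Definition lncmor (c d : lncob) (g : lncgen c d) : @hom LNCB c d :=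
  pgen lncrel g.

(* The sizes of the classes, listed in increasing order of their least element,
   of the equivalence relation on {0, ..., n} generated by j ~ j+1 for s_j in J. *)
Definition adjacent (J : {set 'I_n}) : rel 'I_n.+1 := fun a b =>
  [exists j in J, (a == j :> nat) && (b == j.+1 :> nat)
                  || (b == j :> nat) && (a == j.+1 :> nat)].

Definition class (J : {set 'I_n}) (a : 'I_n.+1) : {set 'I_n.+1} :=
  [set b | connect (adjacent J) a b].

Definition class_sizes (J : {set 'I_n}) : seq nat :=
  [seq #|class J a| | a <- enum 'I_n.+1 & [forall b in class J a, (a <= b)%N]].

End LNCB.

(* Main.v *)
Require Import Defs.
From HB Require Import structures.
From mathcomp Require Import all_boot all_order all_algebra all_fingroup.
From mathcomp Require Import boolp zify.
Import Defs.

(* A subset J with complement of size k cuts {-n, ..., n} into 2k + 1 intervals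
   (blocks), numbered from -k to k. Writing W_I p W_J = x W_J for a composite p of
   atomic cosets, with x minimal, x carries the blocks of J increasingly onto the
   blocks of I, so it induces a signed permutation w in W_k of their numbers; w and
   J determine x and I. The inversions of x are the pairs lying in two blocks whose
   numbers are inverted by w. Since lengths add up in a product uv exactly when no
   pair inverted by v is inverted back by u, lengths add up for products of x's
   exactly when they do for the corresponding w's. The atomic coset a_i corresponds
   to s_i in W_k, and the composition of the basis elements of these cosets is that
   of the nilCoxeter algebra of W_k. By Matsumoto's theorem in W_k, the morphisms
   of the presented category with source c are spanned by elements indexed by W_k;
   they are sent to distinct basis elements, hence the functor is faithful. *)

Set Implicit Arguments.
Unset Strict Implicit.
Unset Printing Implicit Defensive.

Import GRing.Theory Num.Theory Order.TTheory.

Local Open Scope ring_scope.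

(** * Signed transpositions of the integers *)

(** Composition in [Dcat] is defined through Bruhat-maximal elements and the 0-Hecke product; its
    laws are checked on the span of the cosets W_I x W_J = x W_J described above. There the maximal
    element is x w_J. Every element of J is a left descent of y w_K, so the 0-Hecke product absorbs
    the middle factor w_J, and p * q is reduced exactly when the lengths of x and y add up. All
    arguments compare the order of images of integers: an element is determined by its inversions,
    which gives uniqueness of longest elements, of core representatives and of inflations. The
    signed transpositions act on all of Z, so that one formula [sg i] serves both W_n acting on
    points and every W_k acting on block numbers. On the presented side the target of a composite
    depends on its word. Morphisms are therefore packed with their source and target as [arrow]s, on
    which words act as ordinary functions; Matsumoto's theorem is proved for such operators. *)

Definition sg (i : nat) (x : int) : int :=
  if i == 0%N :> nat then (if x == 1 then - 1 else if x == - 1 then 1 else x)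
  else if x == i%:Z then i.+1%:Z else if x == i.+1%:Z then i%:Z
  else if x == - i%:Z then - i.+1%:Z
  else if x == - i.+1%:Z then - i%:Z else x.

Ltac ifs := repeat match goal with
  |- context [if ?b then _ else _] =>
    lazymatch b with
    | context [if _ then _ else _] => fail
    | _ => let E := fresh "E" in case E: b
    end
  end.
Ltac sgl := rewrite /sg; ifs; lia.

Lemma sgK i : involutive (sg i). Proof. by move=> x; sgl. Qed.

Lemma sgN i x : sg i (- x) = - sg i x. Proof. sgl. Qed.

Lemma sg_cross i p q : p < q -> sg i q < sg i p -> q != 0 -> p != - q ->
  (p = i%:Z /\ q = i.+1%:Z) \/ (p = - i.+1%:Z /\ q = - i%:Z).
Proof. sgl. Qed.

Lemma sg_cross2 i p q : p < q -> sg i q < sg i p ->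
  p = i%:Z /\ q = i.+1%:Z \/ p = - i.+1%:Z /\ q = - i%:Z \/
  i = 0%N /\ p = - 1%:Z /\ q = 1%:Z.
Proof. sgl. Qed.

(** An odd injection that carries the neighbours [j], [j+1] to neighbours [i], [i+1], up to order
    and sign, conjugates one signed transposition into the other. The generator s_0 is attached to
    the neighbours 0 and 1 and so fits the same pattern. *)
Lemma sg_conj (g : int -> int) (i j : nat) : injective g ->
  (forall x, g (- x) = - g x) ->
  [\/ g j%:Z = i%:Z /\ g j.+1%:Z = i.+1%:Z,
      g j%:Z = i.+1%:Z /\ g j.+1%:Z = i%:Z,
      g j%:Z = - i.+1%:Z /\ g j.+1%:Z = - i%:Z |
      g j%:Z = - i%:Z /\ g j.+1%:Z = - i.+1%:Z] ->
  forall x, g (sg j x) = sg i (g x).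
Proof.
move=> gI gN H x.
have g0 : g 0 = 0 by have := gN 0; rewrite oppr0; move: (g 0) => z; lia.
have H0 y : g y = 0 -> y = 0 by move=> e; apply: gI; rewrite g0.
have hj := gN j%:Z; have hj1 := gN j.+1%:Z.
(* Since [g] fixes 0, the pair (0, 1) can only correspond to itself up to sign. *)
have hij : (j == 0%N :> nat) = (i == 0%N :> nat).
  apply/eqP/eqP => [j0|i0]; first by case: H; rewrite j0 g0 => -[]; lia.
  have h1 : g j.+1%:Z <> 0 by move/H0.
  have h2 : g j%:Z = 0 -> j = 0%N by move/H0 => [].
  by case: H => -[e1 e2]; apply: h2; move: e1 e2; rewrite i0 => e1 e2; lia.
have E y : (x == y) = (g x == g y) by rewrite (inj_eq gI).
rewrite /sg -hij; case: ifP => j0.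
  rewrite (E 1) (E (- 1)).
  have [ej ei] : j = 0%N /\ i = 0%N by lia.
  have [g1|g1] : g 1 = 1 \/ g 1 = - 1 by move: H; rewrite ej ei g0; case=> -[] ? ->; lia.
    by rewrite gN g1; ifs; rewrite ?gN ?g1.
  by rewrite gN g1 opprK; ifs; rewrite ?gN ?g1 //; lia.
rewrite (E j%:Z) (E j.+1%:Z) (E (- j%:Z)) (E (- j.+1%:Z)).
rewrite hj hj1.
by case: H => [][e1 e2]; rewrite e1 e2; ifs; rewrite ?gN ?e1 ?e2; lia.
Qed.

(** * The action of the concrete group on the integers *)

Section TypeB.
Variable n : nat.
Implicit Types (u v w : WB n) (x y : int) (i j : 'I_n) (t : seq 'I_n).
Local Notation s := (@sB n).

Definition enc (x : int) : 'I_(n.*2.+1) := inord (absz (x + n%:Z)).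

Lemma enc_eq x y : (absz x <= n)%N -> (absz y <= n)%N -> (enc x == enc y) = (x == y).
Proof. by move=> hx hy; rewrite -val_eqE /= !inordK; lia. Qed.

Lemma negXE (j : nat) : (j <= n)%N -> negX n j = enc (- j%:Z).
Proof. by move=> h; apply: val_inj; rewrite /= !inordK; lia. Qed.

Lemma posXE (j : nat) : (j <= n)%N -> posX n j = enc j%:Z.
Proof. by move=> h; apply: val_inj; rewrite /= !inordK; lia. Qed.

Lemma sg_bound i x : (absz x <= n)%N -> (absz (sg i x) <= n)%N.
Proof. by have := ltn_ord i; sgl. Qed.

Lemma tperm_enc a b x :
    (absz a <= n)%N -> (absz b <= n)%N -> (absz x <= n)%N ->
  tperm (enc a) (enc b) (enc x) =
  enc (if x == a then b else if x == b then a else x).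
Proof. by move=> ha hb hx; rewrite permE /= !enc_eq // !(fun_if enc). Qed.

Lemma signed_reflE i x :
  (absz x <= n)%N -> signed_refl i (enc x) = enc (sg i x).
Proof.
move=> hx; have hi := ltn_ord i; rewrite /signed_refl.
case: ifP => i0.
  rewrite negXE ?posXE; [|lia..].
  by rewrite tperm_enc; [|lia..]; congr enc; sgl.
rewrite !negXE ?posXE; [|lia..].
rewrite permM !tperm_enc; [|ifs; lia..].
by congr enc; sgl.
Qed.

(** The inverse turns the left-to-right product of permutations into a left action. Integers outside
    [-n, n] are fixed, so that the generators act as [sg i] on all of Z. *)
Definition swact w x : int :=
  if (absz x <= n)%N then (val ((sgval w)^-1%g (enc x)))%:Z - n%:Z else x.

Lemma swact_bound w x : (absz x <= n)%N -> (absz (swact w x) <= n)%N.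
Proof. move=> h; rewrite /swact h; case: ((sgval w)^-1%g (enc x)) => m hm /=; lia. Qed.

Lemma enc_swact w x : (absz x <= n)%N -> enc (swact w x) = (sgval w)^-1%g (enc x).
Proof.
move=> h; rewrite /swact h; case: ((sgval w)^-1%g (enc x)) => m hm; apply: val_inj => /=.
by rewrite inordK; lia.
Qed.

Lemma swactM u v x : swact (u * v)%g x = swact u (swact v x).
Proof.
have [h|h] := boolP (absz x <= n)%N; last by rewrite {1 3}/swact (negbTE h) /swact (negbTE h).
have h1 := swact_bound v h.
by rewrite {1 2}/swact h h1 enc_swact //= invMg permM.
Qed.

Lemma swact1 x : swact 1%g x = x.
Proof.
rewrite /swact; case: ifP => // h.
by rewrite /= invg1 perm1 /= inordK; lia.
Qed.

Lemma swact_s i x : swact (s i) x = sg i x.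
Proof.
rewrite /swact /=; case: ifP => h.
  have -> : (signed_refl i)^-1%g (enc x) = enc (sg i x).
    by rewrite -{1}(sgK i x) -signed_reflE ?sg_bound // permK.
  have := sg_bound i h; move: (sg i x) => y hy.
  by rewrite /= inordK; lia.
have := ltn_ord i; sgl.
Qed.

Lemma swact_faithful u v : swact u =1 swact v -> u = v.
Proof.
move=> H; apply: val_inj; rewrite /=; apply: invg_inj; apply/permP => z.
have [h e] : (absz ((val z)%:Z - n%:Z)%R <= n)%N /\ enc ((val z)%:Z - n%:Z) = z.
  case: z => m hm /=; split; first by lia.
  by apply: val_inj; rewrite /= inordK; lia.
by rewrite -e -!enc_swact // H.
Qed.

Lemma swprod_onto w : exists t, wprod s t = w.
Proof.
have [m [c hc e]] := gen_prodgP (valP w).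
have [f hf] : exists f : 'I_m -> 'I_n, forall l, c l = signed_refl (f l).
  apply: (@fin_all_exists _ (fun=> 'I_n) (fun l k => c l = signed_refl k)) => l.
  by have /imsetP[k _ ->] := hc l; exists k.
exists [seq f l | l <- index_enum 'I_m]; apply: val_inj; rewrite /= e.
rewrite /wprod big_map (big_morph sgval (id1 := 1%g) (op1 := mulg)) //.
by apply: eq_bigr => l _; rewrite hf.
Qed.

End TypeB.

(* [WB n] is used only through this interface, so that unification never unfolds
   its group law, a composition of permutations. *)
Record sysB (n : nat) := SysB {
  carrier :> finGroupType;
  gen : 'I_n -> carrier;
  wact : carrier -> int -> int;
  wactM : forall u v x, wact (u * v)%g x = wact u (wact v x);
  wact1 : forall x, wact 1%g x = x;
  wact_s : forall i x, wact (gen i) x = sg i x;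
  wact_faithful : forall u v, wact u =1 wact v -> u = v;
  wprod_onto : forall w, exists t, wprod gen t = w
}.

Arguments wactM {n s} : rename.
Arguments wact1 {n s} : rename.
Arguments wact_s {n s} : rename.
Arguments wact_faithful {n s} : rename.
Arguments wprod_onto {n s} : rename.

Definition WBsys (n : nat) : sysB n :=
  SysB (@swactM n) (@swact1 n) (@swact_s n) (@swact_faithful n) (@swprod_onto n).

(** * Words and length *)

Section Length.
Context {n : nat} {X : sysB n}.
Implicit Types (u v w : X) (x y : int) (i j : 'I_n) (t : seq 'I_n).
Local Notation s := (@gen n X).
Local Notation len := (len s).

Lemma wactVK w : cancel (wact w) (wact w^-1%g).
Proof. by move=> x; rewrite -wactM mulVg wact1. Qed.

Lemma wactKV w : cancel (wact w^-1%g) (wact w).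
Proof. by move=> x; rewrite -wactM mulgV wact1. Qed.

Lemma wact_inj w : injective (wact w). Proof. exact: can_inj (wactVK w). Qed.

Lemma wprod_cons i t : wprod s (i :: t) = (s i * wprod s t)%g.
Proof. by rewrite /wprod big_cons. Qed.

Lemma wprod_nil : wprod s [::] = 1%g.
Proof. by rewrite /wprod big_nil. Qed.

Lemma wprod_cat t t' : wprod s (t ++ t') = (wprod s t * wprod s t')%g.
Proof. by rewrite /wprod big_cat. Qed.

Lemma s_sq i : (s i * s i)%g = 1%g.
Proof. by apply: wact_faithful => x; rewrite wactM !wact_s sgK wact1. Qed.

Lemma sK i w : (s i * (s i * w))%g = w.
Proof. by rewrite mulgA s_sq mul1g. Qed.

Lemma sKr i w : (w * s i * s i)%g = w.
Proof. by rewrite -mulgA s_sq mulg1. Qed.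

Lemma sV i : (s i)^-1%g = s i.
Proof. by apply: (mulgI (s i)); rewrite mulgV s_sq. Qed.

Lemma s_inj : injective s.
Proof.
move=> i j e; apply: val_inj => /=.
have := @wact_s n X i i.+1; rewrite e wact_s.
sgl.
Qed.

Lemma wprod_rev t : wprod s (rev t) = (wprod s t)^-1%g.
Proof.
elim: t => [|i t IH]; first by rewrite wprod_nil invg1.
by rewrite rev_cons -cats1 wprod_cat IH !wprod_cons wprod_nil mulg1 invMg sV.
Qed.

Lemma wactN w x : wact w (- x) = - wact w x.
Proof.
have [t <-] := wprod_onto w; elim: t => [|i t IH]; first by rewrite wprod_nil !wact1.
by rewrite wprod_cons !wactM IH !wact_s sgN.
Qed.

Lemma wact0 w : wact w 0 = 0.
Proof. by have := wactN w 0; rewrite oppr0; move: (wact w 0) => z; lia. Qed.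

Lemma wact_eq0 w x : (wact w x == 0) = (x == 0).
Proof. by rewrite -[X in _ == X](wact0 w) (inj_eq (@wact_inj w)). Qed.

Lemma wact_eqN w x y : (wact w x == - wact w y) = (x == - y).
Proof. by rewrite -wactN (inj_eq (@wact_inj w)). Qed.

(** The bounded search in [len] succeeds: the suffixes of a shortest word have distinct values,
    since otherwise a segment could be cut out, so the minimal size is less than the order of the
    group. *)
Lemma len_spec w :
  (exists2 t, size t = len w & wprod s t = w) /\
  (forall t, wprod s t = w -> (len w <= size t)%N).
Proof.
pose P k := [exists t : k.-tuple 'I_n, wprod s t == w].
have exP : exists k, P k.
  have [t e] := wprod_onto w; exists (size t); apply/existsP.
  by exists (in_tuple t); apply/eqP.
case: (ex_minnP exP) => m Pm mmin.
have minw t : wprod s t = w -> (m <= size t)%N.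
  by move=> e; apply: mmin; apply/existsP; exists (in_tuple t); apply/eqP.
have [t /eqP et] := existsP Pm.
have mlt : (m < #|X|)%N.
  pose f (l : 'I_m.+1) := wprod s (drop l t).
  have finj (l l' : 'I_m.+1) : (l < l')%N -> f l = f l' -> False.
    move=> ll e; have := minw (take l t ++ drop l' t).
    rewrite wprod_cat -/(f l') -e -wprod_cat cat_take_drop et => /(_ erefl).
    rewrite size_cat size_takel ?size_drop ?size_tuple; have := ltn_ord l'; lia.
  rewrite -[X in (X <= _)%N](card_ord m.+1); apply: (@leq_card _ _ f) => l l' e.
  case: (ltngtP l l') => [h|h|//]; [by case: (finj _ _ h)|by case: (finj _ _ h)|exact: val_inj].
suff -> : len w = m by split => //; exists t; rewrite ?size_tuple.
rewrite /Defs.len -/P.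
have hm : has P (iota 0 #|X|).
  by apply/hasP; exists m => //; rewrite mem_iota.
have h := nth_find 0%N hm; rewrite has_find size_iota in hm.
rewrite nth_iota // add0n in h.
apply/eqP; rewrite eqn_leq mmin // andbT.
rewrite leqNgt; apply/negP => lt; have := before_find 0%N lt.
by rewrite nth_iota // add0n Pm.
Qed.

Lemma lenP w : exists2 t, size t = len w & wprod s t = w.
Proof. exact: (len_spec w).1. Qed.

Lemma len_min t : (len (wprod s t) <= size t)%N.
Proof. exact: (len_spec (wprod s t)).2. Qed.

Lemma len_mul u v : (len (u * v)%g <= len u + len v)%N.
Proof.
have [t <- <-] := lenP u; have [t' <- <-] := lenP v.
by rewrite -wprod_cat -size_cat len_min.
Qed.

Lemma len1 : len 1%g = 0%N.
Proof. by apply/eqP; rewrite -leqn0 -wprod_nil len_min. Qed.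

Lemma len0 w : len w = 0%N -> w = 1%g.
Proof. by have [t <- <-] := lenP w => /size0nil ->; rewrite wprod_nil. Qed.

Lemma lenV w : len w^-1%g = len w.
Proof.
have H z : (len z^-1%g <= len z)%N.
  by have [t <- <-] := lenP z; rewrite -wprod_rev -(size_rev t) len_min.
have h1 := H w; have := H w^-1%g; rewrite invgK => h2; lia.
Qed.

Lemma len_s i : (len (s i) <= 1)%N.
Proof. by have := len_min [:: i]; rewrite wprod_cons wprod_nil mulg1. Qed.

End Length.

(** * Exchange and additivity of the length *)

Section Exchange.
Context {n : nat} {X : sysB n}.
Implicit Types (u v w : X) (x y : int) (i j : 'I_n) (t : seq 'I_n).
Local Notation s := (@gen n X).
Local Notation len := (len s).

(** For [i] = 0 this says that the image of 1 is negative, because 0 is fixed; one inequality thus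
    describes the right descents at all generators. *)
Definition desc w (i : nat) : bool := wact w i.+1%:Z < wact w i%:Z.

Lemma conj_s w i j : 
  [\/ wact w j%:Z = i%:Z /\ wact w j.+1%:Z = i.+1%:Z,
      wact w j%:Z = i.+1%:Z /\ wact w j.+1%:Z = i%:Z,
      wact w j%:Z = - i.+1%:Z /\ wact w j.+1%:Z = - i%:Z |
      wact w j%:Z = - i%:Z /\ wact w j.+1%:Z = - i.+1%:Z] ->
  (w * s j = s i * w)%g.
Proof.
move=> H; apply: wact_faithful => x; rewrite !wactM !wact_s.
exact: (sg_conj (@wact_inj n X w) (@wactN n X w) H).
Qed.

Lemma wact_cross w i j : wact w j%:Z < wact w j.+1%:Z ->
  sg i (wact w j.+1%:Z) < sg i (wact w j%:Z) -> (w * s j = s i * w)%g.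
Proof.
move=> lt gt; apply: conj_s.
have h0 : wact w j.+1%:Z != 0 by rewrite wact_eq0; lia.
have h1 : wact w j%:Z != - wact w j.+1%:Z by rewrite wact_eqN; lia.
by case: (sg_cross lt gt h0 h1); [constructor 1|constructor 3].
Qed.

(** Reading the word from the right, some letter [i] first reverses the images of [j] and [j+1];
    that letter is the one deleted. *)
Lemma exchange t j : desc (wprod s t) j ->
  exists2 t', size t = (size t').+1 & (wprod s t * s j)%g = wprod s t'.
Proof.
elim: t => [|i t IH]; first by rewrite /desc wprod_nil !wact1; lia.
rewrite /desc wprod_cons !wactM !wact_s => H.
case: (ltrP (wact (wprod s t) j.+1%:Z) (wact (wprod s t) j%:Z)) => [/IH[t' e e']|le].
  by exists (i :: t'); rewrite /= ?e // wprod_cons -mulgA e'.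
(* The letter [i] creates the descent, so moving [s j] to the left across [wprod t] turns it into
   [s i], which cancels this letter. *)
exists t => //; rewrite -mulgA (@wact_cross _ i) ?sK //.
by rewrite lt_neqAle le andbT (inj_eq (@wact_inj n X _)); lia.
Qed.

Lemma len_desc w j : desc w j -> len w = (len (w * s j)%g).+1.
Proof.
move=> H; have [t e e'] := lenP w; move: H; rewrite -e' => /exchange[t' e2 e3].
have := @len_min n X t'; rewrite -e3 e' => h.
have := len_mul (w * s j) (s j); rewrite sKr; have := @len_s n X j; lia.
Qed.

Lemma desc_s w j : desc (w * s j)%g j = ~~ desc w j.
Proof.
rewrite /desc !wactM !wact_s.
have e1 := wact_eq0 w 1; have e2 := wactN w 1; have e3 := inj_eq (@wact_inj n X w) j%:Z j.+1%:Z.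
have [j0|j0] := boolP (j == 0%N :> nat).
  have -> : sg j j.+1%:Z = - 1 by sgl.
  have -> : sg j j%:Z = 0 by sgl.
  have -> : j%:Z = 0 by lia.
  have -> : j.+1%:Z = 1 by lia.
  rewrite e2 wact0; lia.
have -> : sg j j.+1%:Z = j%:Z by sgl.
have -> : sg j j%:Z = j.+1%:Z by sgl.
lia.
Qed.

Lemma len_ndesc w j : ~~ desc w j -> len (w * s j)%g = (len w).+1.
Proof. by rewrite -desc_s => /len_desc ->; rewrite sKr. Qed.

Lemma descE w j : desc w j = (len (w * s j)%g < len w)%N.
Proof.
by have [/len_desc ->|/len_ndesc ->] := boolP (desc w j); lia.
Qed.

Lemma ldescE w j : desc w^-1%g j = (len (s j * w)%g < len w)%N.
Proof. by rewrite descE -(lenV w) -(lenV (s j * w)) invMg sV. Qed.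

Lemma len_lmul w j :
  len (s j * w)%g = if desc w^-1%g j then (len w).-1 else (len w).+1.
Proof.
rewrite -(lenV w) -(lenV (s j * w)) invMg sV.
by case: ifP => [/len_desc ->|/negbT/len_ndesc ->].
Qed.

Lemma desc_ex w : w != 1%g -> exists j, desc w j.
Proof.
move=> w1; have [t e e'] := lenP w; case/lastP: t e e' => [|t j] e e'.
  by move: w1; rewrite -e' wprod_nil eqxx.
exists j; rewrite descE -e -e' -cats1 wprod_cat wprod_cons wprod_nil mulg1 sKr.
by rewrite size_cat addn1 ltnS len_min.
Qed.

(** If u v^-1 were not 1 it would have a descent at some [j]; the preimages of [j] and [j+1] under
    [v] then form a pair that [u] and [v] order differently. *)
Lemma inv_determined u v :
  (forall x y, x < y -> (wact u y < wact u x) = (wact v y < wact v x)) -> u = v.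
Proof.
move=> H; apply: (mulIg v^-1%g); rewrite mulgV; apply/eqP/negPn/negP => /desc_ex[j].
rewrite /desc !wactM.
set x := wact v^-1%g j; set y := wact v^-1%g j.+1.
have ex : wact v x = j by rewrite /x wactKV.
have ey : wact v y = j.+1 by rewrite /y wactKV.
case: (ltgtP x y) => [h|h|e]; last by rewrite e ltxx.
- by rewrite H // ex ey; lia.
- have := H _ _ h; rewrite ex ey ltNge le_eqVlt => e l; move: e; rewrite l orbT; lia.
Qed.

Lemma cross_mono w j x y : ~~ desc w j ->
  x < y -> sg j y < sg j x -> wact w x < wact w y.
Proof.
rewrite /desc -leNgt le_eqVlt (inj_eq (@wact_inj n X _)) => /orP[|h]; first lia.
move=> lt gt; case: (sg_cross2 lt gt) => [[-> ->]|[[-> ->]|[j0 [-> ->]]]] //.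
  by rewrite !wactN ltrN2.
move: h; rewrite wactN j0.
have -> : wact w 0%N = 0 by exact: wact0.
move: (wact w 1%N) => z; lia.
Qed.

Definition nocross u v := forall x y,
  x < y -> wact v y < wact v x -> wact u (wact v y) < wact u (wact v x).

(** Induction on the length of [v]: its first letter [s j] is moved to [u]. The inversions of v'
    stay inversions of v = s_j v', and the new ones come from pairs whose images under v' are
    crossed by [s j]. *)
Lemma addP u v : (len (u * v)%g = len u + len v)%N <-> nocross u v.
Proof.
move: {2}(len v) (erefl (len v)) => m; elim: m v u => [|m IH] v u em.
  rewrite (len0 em) mulg1 len1 addn0; split=> // _ x y; rewrite !wact1; lia.
have [j dj] : exists j, desc v^-1%g j.
  apply: desc_ex; apply/eqP => e; move: em; rewrite -(invgK v) e invg1 len1; lia.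
have [v' Ev'] : exists v', v' = (s j * v)%g by exists (s j * v)%g.
have ev : v = (s j * v')%g by rewrite Ev' sK.
have em' : len v' = m by rewrite Ev' len_lmul dj em.
have up : ~~ desc v'^-1%g j by rewrite Ev' invMg sV desc_s dj.
have wv y : wact v y = sg j (wact v' y) by rewrite ev wactM wact_s.
have sub x y : x < y -> wact v' y < wact v' x -> wact v y < wact v x.
  move=> xy lt; rewrite !wv ltNge; apply/negP; rewrite le_eqVlt (can_eq (sgK j)) => /orP[|gt].
    by rewrite (inj_eq (@wact_inj n X _)); lia.
  by have := cross_mono up lt gt; rewrite !wactVK; lia.
have -> : (u * v = (u * s j) * v')%g by rewrite ev !mulgA.
have {IH} [IH1 IH2] := IH v' (u * s j)%g em'; split=> [e|nc].
  have nd : ~~ desc u j.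
    apply/negP => /len_desc h; have := len_mul (u * s j) v'; lia.
  have nc : nocross (u * s j)%g v' by apply: IH1; have := len_ndesc nd; lia.
  move=> x y xy lt; case: (ltrP (wact v' y) (wact v' x)) => [h|h].
    by have := nc x y xy h; rewrite !wactM !wact_s -!wv.
  apply: (cross_mono nd lt); rewrite !wv !sgK lt_neqAle h andbT.
  by rewrite (inj_eq (@wact_inj n X _)); lia.
have nd : ~~ desc u j.
  rewrite -desc_s /desc !wactM !wact_s.
  (* The preimages of [j] and [j+1] under v' form an inversion of [v], which [u] does not undo. *)
  have h := wactKV v' j%:Z; have h1 := wactKV v' j.+1%:Z.
  rewrite -{1}h -{1}h1 -!wv; apply: nc.
    move: up; rewrite /desc -leNgt le_eqVlt (inj_eq (@wact_inj n X _)); lia.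
  by rewrite !wv h h1; sgl.
have h2 := len_ndesc nd.
suff h3 : nocross (u * s j)%g v' by have := IH2 h3; lia.
move=> x y xy lt; rewrite !wactM !wact_s -!wv; apply: nc => //; exact: sub.
Qed.

End Exchange.

(** * The 0-Hecke product and Matsumoto's theorem *)

Section Star.
Context {n : nat} {X : sysB n}.
Implicit Types (u v w : X) (x y : int) (i j : 'I_n) (t : seq 'I_n).
Local Notation s := (@gen n X).
Local Notation len := (len s).

Local Notation star1 := (star1 s).
Local Notation star := (star s).
Local Notation redword := (redword s).
Local Notation wprod := (wprod s).

(* [mulgA] may introduce other canonical instances of the product, which [lia]
   does not identify. *)
Lemma wmulA u v w : (u * v * w)%g = (u * (v * w))%g.
Proof. by rewrite mulgA. Qed.

Lemma redwordP w : size (redword w) = len w /\ wprod (redword w) = w.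
Proof.
rewrite /Defs.redword; case: pickP => [t /eqP e|H]; first by rewrite size_tuple.
have [t e e'] := lenP w; have et : size t == len w by rewrite e.
by have := H (Tuple et); rewrite /= e' eqxx.
Qed.

Lemma star1E i w : star1 i w = if desc w^-1%g i then w else (s i * w)%g.
Proof.
rewrite /Defs.star1 len_lmul; case: (desc _ _); last by rewrite ltnSn.
by rewrite ltnNge leq_pred.
Qed.

Definition rstar1 (j : 'I_n) w := if desc w j then w else (w * s j)%g.

(** By [wact_cross], left multiplication by [s i] can reverse the images of [j] and [j+1] only when
    it agrees with right multiplication by [s j]. *)
Lemma desc_lmul i j w : (w * s j != s i * w)%g -> desc (s i * w)%g j = desc w j.
Proof.
move=> ne; have inj v := inj_eq (@wact_inj n X v) j%:Z j.+1%:Z.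
have lt v : ~~ desc v j -> wact v j%:Z < wact v j.+1%:Z.
  by rewrite /desc -leNgt le_eqVlt inj => /orP[|//]; lia.
apply/idP/idP => d; apply/negPn/negP => /lt nd; case/eqP: ne.
  by apply: wact_cross nd _; move: d; rewrite /desc !wactM !wact_s.
apply: (mulgI (s i)); rewrite sK mulgA (@wact_cross n X _ i j) //.
  by rewrite mulgA s_sq mul1g.
by rewrite !wactM !wact_s !sgK.
Qed.

(** If w s_j = s_i w, the left and the right operator do the same to [w]. Otherwise neither
    multiplication affects the descent tested by the other operator. *)
Lemma star1_rstar1 i j w : star1 i (rstar1 j w) = rstar1 j (star1 i w).
Proof.
have [e|ne] := eqVneq (w * s j)%g (s i * w)%g.
  have ed : desc w^-1%g i = desc w j by rewrite ldescE descE e.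
  case d: (desc w j); rewrite /rstar1 !star1E ed d /= ?d ?ed ?d //.
  by rewrite -e desc_s d /= {1}e invMg sV desc_s ed d.
have d1 := desc_lmul ne.
have d2 : desc (w * s j)^-1%g i = desc w^-1%g i.
  rewrite invMg sV desc_lmul //; apply: contraNneq ne => e.
  by apply/eqP/invg_inj; rewrite !invMg !sV e.
rewrite /rstar1 !star1E; case dw: (desc w j); case dl: (desc w^-1%g i);
  by rewrite /= ?d1 ?d2 ?dw ?dl -?wmulA.
Qed.

Lemma foldr_star1_rstar1 t j w :
  foldr star1 (rstar1 j w) t = rstar1 j (foldr star1 w t).
Proof. by elim: t => //= i t ->; rewrite star1_rstar1. Qed.

(* Every [w] is obtained from 1 by right operators [rstar1], which commute with
   the left ones, so the left action of a word is determined by its value at 1. *)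
Lemma foldr_star1_eq t t' : foldr star1 1%g t = foldr star1 1%g t' ->
  forall w, foldr star1 w t = foldr star1 w t'.
Proof.
move=> e w; move: {2}(len w) (erefl (len w)) => m; elim: m w => [|m IH] w ew.
  by rewrite (len0 ew).
have [j dj] : exists j, desc w j.
  by apply: desc_ex; apply/eqP => e1; move: ew; rewrite e1 len1.
have -> : w = rstar1 j (w * s j)%g by rewrite /rstar1 desc_s dj sKr.
rewrite !foldr_star1_rstar1 IH //.
by move: ew; rewrite (len_desc dj) => -[].
Qed.

Lemma foldr_star1_add t w :
  size t = len (wprod t) -> len (wprod t * w)%g = (size t + len w)%N ->
  foldr star1 w t = (wprod t * w)%g.
Proof.
elim: t => [|i t IH] /=; first by rewrite wprod_nil mul1g.
rewrite wprod_cons wmulA => e1 e2.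
have h1 := @len_min n X t; have h2 := len_mul (s i) (wprod t); have h3 := @len_s n X i.
have h4 := len_mul (s i) (wprod t * w); have h5 := len_mul (wprod t) w.
rewrite IH; [|by clear IH; lia..].
rewrite star1E; case: ifP => // d.
by exfalso; have := len_lmul (wprod t * w) i; rewrite d; lia.
Qed.

(** The reduced word chosen by [redword] may be replaced by any other one: both give [wprod t] when
    applied to 1, and the value at 1 determines the operator. *)
Lemma star_word t w : size t = len (wprod t) -> star (wprod t) w = foldr star1 w t.
Proof.
move=> e; have [e1 e2] := redwordP (wprod t).
apply: foldr_star1_eq; by rewrite !foldr_star1_add ?e2 ?mulg1 ?len1 ?addn0 ?e1.
Qed.

Lemma star_mul u v w :
  len (u * v)%g = (len u + len v)%N -> star (u * v)%g w = star u (star v w).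
Proof.
have [e1 e2] := redwordP u; have [e3 e4] := redwordP v => e.
rewrite -{1}e2 -{1}e4 -wprod_cat star_word.
  by rewrite foldr_cat /Defs.star.
by rewrite size_cat wprod_cat e2 e4 e1 e3 e.
Qed.

Lemma star_add u v : len (u * v)%g = (len u + len v)%N -> star u v = (u * v)%g.
Proof.
have [e1 e2] := redwordP u => e; rewrite /Defs.star foldr_star1_add ?e2 //.
by rewrite e1.
Qed.

Lemma foldr_star1_absorb t w :
  (forall i, i \in t -> desc w^-1%g i) -> foldr star1 w t = w.
Proof.
elim: t => //= i t IH H; rewrite IH => [|k kt]; last by apply: H; rewrite inE kt orbT.
by rewrite star1E H // inE eqxx.
Qed.

Definition commuting (i j : nat) := (i.+1 < j)%N || (j.+1 < i)%N.

Lemma braid2 i j : commuting i j -> (s i * s j = s j * s i)%g.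
Proof.
rewrite /commuting => h; apply: conj_s; constructor 1.
by rewrite !wact_s; split; sgl.
Qed.

Lemma braid3 i j : (0 < i)%N -> j = i.+1 :> nat ->
  (s i * (s j * s i) = s j * (s i * s j))%g.
Proof.
move=> h e; rewrite -wmulA; apply: conj_s; constructor 1; rewrite !wactM !wact_s e.
by rewrite (_ : sg i.+1 i = i) 1?(_ : sg i.+1 i.+1 = i.+2); try split; sgl.
Qed.

Lemma braid4 i j : i = 0%N :> nat -> j = 1%N :> nat ->
  (s i * (s j * (s i * s j)) = s j * (s i * (s j * s i)))%g.
Proof.
move=> e e'; rewrite -!(wmulA (s j)) -(wmulA (s j * s i)).
by symmetry; apply: conj_s; constructor 1; rewrite !wactM !wact_s e e'.
Qed.

Lemma ldesc_mul i j w :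
  desc (s i * w)^-1%g j = (wact w^-1%g (sg i j.+1%:Z) < wact w^-1%g (sg i j%:Z)).
Proof. by rewrite /desc invMg sV !wactM !wact_s. Qed.

Lemma len_ldesc w i : desc w^-1%g i -> len w = (len (s i * w)%g).+1.
Proof. by move/len_desc; rewrite -(lenV (s i * w)) invMg sV lenV. Qed.

(** When [i] and [j] are both left descents, the longest element of the dihedral group generated by
    [s i] and [s j] splits off on the left with additive length. This lemma and the next two treat
    the orders 2, 3 and 4 of s_i s_j. *)
Lemma ldesc2 w i j : commuting i j -> desc w^-1%g i -> desc w^-1%g j ->
  exists2 v, w = (s i * (s j * v))%g & len w = (len v).+2.
Proof.
move=> ij di dj; exists (s j * (s i * w))%g; first by rewrite !sK.
have dj' : desc (s i * w)^-1%g j.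
  rewrite ldesc_mul; move: dj; rewrite /desc.
  have -> : sg i j.+1 = j.+1 by move: ij; rewrite /commuting; sgl.
  by have -> : sg i j = j by move: ij; rewrite /commuting; sgl.
by rewrite (len_ldesc di) (len_ldesc dj').
Qed.

Lemma ldesc3 w i j : (0 < i)%N -> j = i.+1 :> nat ->
    desc w^-1%g i -> desc w^-1%g j ->
  exists2 v, w = (s i * (s j * (s i * v)))%g & len w = (len v).+3.
Proof.
move=> i0 ij di dj; exists (s i * (s j * (s i * w)))%g; first by rewrite !sK.
have [a b] : sg i i = i.+1 /\ sg i i.+1 = i by split; sgl.
have [c d] : sg j i.+1 = i.+2 /\ sg i i.+2 = i.+2 by split; sgl.
have e : sg j i = i by sgl.
move: di dj; rewrite {1 2}/desc ij => h1 h2.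
have d1 : desc w^-1%g i by [].
have d2 : desc (s i * w)^-1%g j by rewrite ldesc_mul ij d b; lia.
have d3 : desc (s j * (s i * w))^-1%g i.
  by rewrite ldesc_mul c e invMg sV !wactM !wact_s a d.
by rewrite (len_ldesc d1) (len_ldesc d2) (len_ldesc d3).
Qed.

Lemma ldesc4 w i j : i = 0%N :> nat -> j = 1%N :> nat ->
    desc w^-1%g i -> desc w^-1%g j ->
  exists2 v, w = (s i * (s j * (s i * (s j * v))))%g & len w = (len v).+4.
Proof.
move=> i0 j1 di dj; exists (s j * (s i * (s j * (s i * w))))%g; first by rewrite !sK.
move: di dj; rewrite {1 2}/desc i0 j1 => h1 h2.
have h0 : wact w^-1%g 0%N = 0 by exact: wact0.
have N := wactN w^-1%g; have N1 := N 1%N; have N2 := N 2%N.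
rewrite h0 in h1.
have d1 : desc w^-1%g i by rewrite /desc i0 h0.
have d2 : desc (s i * w)^-1%g j.
  rewrite ldesc_mul i0 j1 (_ : sg 0 2 = 2%N) // (_ : sg 0 1 = - 1%N%:Z) // N1.
  by move: h1 h2; move: (wact _ _) (wact _ _) => a b; lia.
have d3 : desc (s j * (s i * w))^-1%g i.
  rewrite ldesc_mul invMg sV !wactM !wact_s i0 j1.
  by rewrite (_ : sg 0 (sg 1 1) = 2%N) // (_ : sg 0 (sg 1 0) = 0%N) // h0 (lt_trans h2 h1).
have d4 : desc (s i * (s j * (s i * w)))^-1%g j.
  rewrite ldesc_mul !invMg !sV !wactM !wact_s i0 j1.
  rewrite (_ : sg 0 (sg 1 (sg 0 2)) = - 1%N%:Z) // (_ : sg 0 (sg 1 (sg 0 1)) = - 2%N%:Z) //.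
  by rewrite !wactN ltrN2.
by rewrite (len_ldesc d1) (len_ldesc d2) (len_ldesc d3) (len_ldesc d4).
Qed.

(** Stated for operators on an invariant part [P] of [A], because the generators of the presented
    category exist only at objects with enough parts. Induction on the size of the words; equal
    first letters are handled by the induction hypothesis. *)
Lemma matsumoto (A : Type) (F : 'I_n -> A -> A) (P : A -> Prop) :
    (forall i a, P a -> P (F i a)) ->
    (forall i j a, P a -> commuting i j -> F i (F j a) = F j (F i a)) ->
    (forall i j a, P a -> (0 < i)%N -> j = i.+1 :> nat ->
       F i (F j (F i a)) = F j (F i (F j a))) ->
    (forall i j a, P a -> i = 0%N :> nat -> j = 1%N :> nat ->
       F i (F j (F i (F j a))) = F j (F i (F j (F i a)))) ->
  forall t t' a, P a -> size t = len (wprod t) -> size t' = size t ->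
    wprod t = wprod t' -> foldr F a t = foldr F a t'.
Proof.
move=> PF F2 F3 F4 t t' a Pa.
have PFs r : P (foldr F a r) by elim: r => //= i r; apply: PF.
move: {2}(size t) (erefl (size t)) => m; elim: m t t' => [|m IH].
  by move=> t t' /size0nil -> _ /size0nil ->.
move=> [//|i t] [//|j t'] [em] el [em'].
have [w ew] : exists w, w = wprod (i :: t) by exists (wprod (i :: t)).
rewrite /= em in el; rewrite -ew in el *.
rewrite wprod_cons in ew; rewrite wprod_cons em in em' * => ew'.
have D k r : size r = m -> w = (s k * wprod r)%g ->
    desc w^-1%g k /\ size r = len (wprod r).
  move=> er e; have h1 := @len_min n X r; have h2 := len_mul (s k) (wprod r).
  have h3 := @len_s n X k; rewrite -e in h2; split; last lia.
  by rewrite ldescE {1}e sK; lia.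
have step k r r' : size r = m -> size r' = m -> w = (s k * wprod r)%g ->
    w = (s k * wprod r')%g -> F k (foldr F a r) = F k (foldr F a r').
  move=> h1 h2 e1 e2; congr F; apply: IH => //; last 2 first.
  - by rewrite h1.
  - by apply: (mulgI (s k)); rewrite -e1.
  by have [] := D k r h1 e1.
(* Distinct first letters are both left descents of [w]. By [ldesc2], [ldesc3] or [ldesc4], [w] also
   has reduced words beginning with either side of the braid relation; [step] changes the tails into
   those, and the relation of [F] joins them. *)
suff main i' j' r r' : (i' < j')%N -> size r = m -> size r' = m ->
    w = (s i' * wprod r)%g -> w = (s j' * wprod r')%g ->
    F i' (foldr F a r) = F j' (foldr F a r').
  rewrite /=; case: (ltngtP i j) => [ij|ji|/val_inj eij].
  - by apply: main.
  - by apply: esym; apply: main.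
  - by move: ew'; rewrite -eij => ew'; apply: step.
move=> ij h1 h2 e1 e2; have [d1 _] := D _ _ h1 e1; have [d2 _] := D _ _ h2 e2.
have [c|nc] := boolP (commuting i' j').
  have [v ev lv] := ldesc2 c d1 d2; have [z1 z2] := redwordP v.
  have q1 : F i' (foldr F a r) = F i' (foldr F a (j' :: redword v)).
    apply: step => //; first by rewrite /= z1; lia.
    by rewrite !wprod_cons z2.
  have q2 : F j' (foldr F a r') = F j' (foldr F a (i' :: redword v)).
    apply: step => //; first by rewrite /= z1; lia.
    by rewrite !wprod_cons z2 ev -?wmulA; congr mulg; rewrite ?wmulA braid2 ?wmulA.
  by rewrite q1 q2 /= (F2 i').
have ij1 : j' = i'.+1 :> nat by move: nc; rewrite /commuting; lia.
have [i0|i0] := eqVneq (val i') 0%N.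
  have j1 : j' = 1%N :> nat by rewrite ij1 i0.
  have [v ev lv] := ldesc4 i0 j1 d1 d2; have [z1 z2] := redwordP v.
  have q1 : F i' (foldr F a r) = F i' (foldr F a [:: j', i', j' & redword v]).
    apply: step => //; first by rewrite /= z1; lia.
    by rewrite !wprod_cons z2.
  have q2 : F j' (foldr F a r') = F j' (foldr F a [:: i', j', i' & redword v]).
    apply: step => //; first by rewrite /= z1; lia.
    by rewrite !wprod_cons z2 ev -?wmulA; congr mulg; rewrite ?wmulA (braid4 i0 j1) ?wmulA.
  by rewrite q1 q2 /= (F4 i').
have {}i0 : (0 < i')%N by rewrite lt0n.
have [v ev lv] := ldesc3 i0 ij1 d1 d2; have [z1 z2] := redwordP v.
have q1 : F i' (foldr F a r) = F i' (foldr F a [:: j', i' & redword v]).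
  apply: step => //; first by rewrite /= z1; lia.
  by rewrite !wprod_cons z2.
have q2 : F j' (foldr F a r') = F j' (foldr F a [:: i', j' & redword v]).
  apply: step => //; first by rewrite /= z1; lia.
  by rewrite !wprod_cons z2 ev -?wmulA; congr mulg; rewrite ?wmulA (braid3 i0 ij1) ?wmulA.
by rewrite q1 q2 /= (F3 i').
Qed.

End Star.

(** * Blocks and parabolic subgroups *)

Section Blocks.
Context {n : nat} {X : sysB n}.
Implicit Types (u v w : X) (x y : int) (i j : 'I_n) (t : seq 'I_n).
Local Notation s := (@gen n X).
Local Notation len := (len s).

Implicit Types (I J K M : {set 'I_n}).

(** False for [m] at least [n], so every integer outside [-n, n] is a block by itself and the block
    numbers exhaust Z. *)
Definition inJ J (m : nat) : bool := [exists d : 'I_n, (d \in J) && (d == m :> nat)].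

Lemma inJ_ord J (d : 'I_n) : inJ J d = (d \in J).
Proof.
apply/existsP/idP => [[e /andP[eJ /eqP/val_inj <-]]//|dJ].
by exists d; rewrite dJ eqxx.
Qed.

Lemma inJP J m : inJ J m -> exists2 d : 'I_n, d \in J & m = d.
Proof. by case/existsP => d /andP[dJ /eqP <-]; exists d. Qed.

(* [bl J x] is the signed number of the block of [x], where the blocks are the
   maximal intervals of consecutive integers joined by the [s_j], [j \in J]. *)
Definition bn J (m : nat) : nat := \sum_(i < m) ~~ inJ J i.

Definition bl J (x : int) : int :=
  match x with Posz m => (bn J m)%:Z | Negz m => - (bn J m.+1)%:Z end.

(* [x] and [x + 1] are exchanged by [s_(fidx x)]. *)
Definition fidx (x : int) : nat := match x with Posz m => m | Negz m => m end.

Lemma bnS J m : bn J m.+1 = (bn J m + ~~ inJ J m)%N.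
Proof. by rewrite /bn big_ord_recr. Qed.

Lemma bl_step J x : bl J (x + 1) = bl J x + (~~ inJ J (fidx x))%:Z.
Proof.
case: x => [m|[|m]].
- have -> : Posz m + 1 = Posz m.+1 by lia.
  rewrite /bl /fidx bnS; lia.
- have -> : Negz 0 + 1 = Posz 0 by lia.
  rewrite /bl /fidx bnS /bn big_ord0; lia.
- have -> : Negz m.+1 + 1 = Negz m by lia.
  rewrite /bl /fidx (bnS _ m.+1); lia.
Qed.

Lemma blN J x : bl J (- x) = - bl J x.
Proof.
case: x => [[|m]|m] //=; last by rewrite opprK.
by rewrite /bn big_ord0.
Qed.

Lemma bl0 J : bl J 0 = 0. Proof. by rewrite /= /bn big_ord0. Qed.

Lemma int_ind_ge (P : int -> int -> Prop) :
  (forall x, P x x) -> (forall x y, x <= y -> P x y -> P x (y + 1)) ->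
  forall x y, x <= y -> P x y.
Proof.
move=> P0 PS x y xy; have -> : y = x + (absz (y - x))%:Z by lia.
elim: (absz _) => [|m IH]; first by rewrite addr0.
have -> : x + m.+1%:Z = (x + m%:Z) + 1 by lia.
by apply: PS => //; lia.
Qed.

Lemma bl_mono J x y : x <= y -> bl J x <= bl J y.
Proof.
by move: x y; apply: int_ind_ge => // x y _ h; rewrite bl_step; lia.
Qed.

Lemma bl_lt J x y : bl J x < bl J y -> x < y.
Proof. by apply: contraTT; rewrite -!leNgt; apply: bl_mono. Qed.

Lemma bl_adj J x : (bl J (x + 1) == bl J x) = inJ J (fidx x).
Proof. by rewrite bl_step; case: (inJ _ _); lia. Qed.

Lemma bl_surj J p : exists x, bl J x = p.
Proof.
have H (q : nat) : exists m, bn J m = q.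
  have ex : exists m, (q <= bn J m)%N.
    exists (n + q)%N; elim: q => [|q IH]; first exact: leq0n.
    rewrite addnS bnS; case E: (inJ J _) => /=; last by rewrite addn1.
    by have [d _] := inJP E; have := ltn_ord d; lia.
  case: (ex_minnP ex) => m qm mmin; exists m.
  apply/eqP; rewrite eqn_leq qm andbT; case: m mmin qm => [|m] mmin qm.
    by rewrite /bn big_ord0.
  have := mmin m; rewrite bnS ltnn => h; case: leqP h qm => [_ /(_ isT)//|h _].
  by rewrite bnS; move: h; case: (~~ _) => /=; lia.
case: p => q; first by have [m <-] := H q; exists m%:Z.
have [m e] := H q.+1; exists (- m%:Z); rewrite blN /= e; lia.
Qed.

(** A monotone function onto Z grows by 0 or 1 at each step, and the last hypothesis says which;
    oddness fixes the value at 0. *)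
Lemma bl_unique J (f : int -> int) :
    (forall x, f (- x) = - f x) -> (forall x y, x <= y -> f x <= f y) ->
    (forall p, exists x, f x = p) ->
    (forall m : nat, (f m.+1%:Z == f m%:Z) = inJ J m) ->
  f =1 bl J.
Proof.
move=> fN fM fS fJ; have f0 : f 0 = 0.
  by have := fN 0; rewrite oppr0; move: (f 0) => z; lia.
have H (m : nat) : f m%:Z = bl J m%:Z.
  elim: m => [|m IH]; first by rewrite bl0.
  have e := fJ m; have le : f m%:Z <= f m.+1%:Z by apply: fM; lia.
  have := bl_step J m; rewrite (_ : m%:Z + 1 = m.+1%:Z) /fidx; last lia.
  move=> ->; rewrite -IH -e.
  have [y ey] := fS (f m%:Z + 1).
  have le2 : f m.+1%:Z <= f m%:Z + 1.
    rewrite -ey; case: (lerP m.+1%:Z y) => h; first exact: fM.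
    have h' : y <= m%:Z by lia.
    by have := fM _ _ h'; lia.
  case: eqP => /=; lia.
case=> m; first exact: H.
by rewrite NegzE fN H blN.
Qed.

Lemma bl_inj I J : bl I =1 bl J -> I = J.
Proof.
by move=> e; apply/setP => d; rewrite -!inJ_ord -!(bl_adj _ d%:Z) !e.
Qed.

Lemma bl_between J x y z : x <= y -> y <= z -> bl J x = bl J z -> bl J y = bl J x.
Proof. by move=> /(bl_mono J) h /(bl_mono J) h'; lia. Qed.

Lemma chain_block J (R : rel int) (f : int -> int) : transitive R ->
    (forall x, inJ J (fidx x) -> R (f x) (f (x + 1))) ->
  forall x y, x < y -> bl J x = bl J y -> R (f x) (f y).
Proof.
move=> tR H x y xy.
have : forall x' y', x' <= y' -> x' < y' -> bl J x' = bl J y' -> R (f x') (f y').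
  apply: int_ind_ge => [x'|x' y' le IH _ e]; first by rewrite ltxx.
  have e' : bl J y' = bl J x' by apply: bl_between e => //; lia.
  have adj : R (f y') (f (y' + 1)) by apply: H; rewrite -bl_adj -e e'.
  case: (ltrP x' y') => [lt|ge]; first by apply: tR adj; apply: IH.
  by have -> : x' = y' by lia.
by apply => //; apply: ltW.
Qed.

Lemma desc_fidx w x : (wact w (x + 1) < wact w x) = desc w (fidx x).
Proof.
rewrite /desc; case: x => m /=; first by rewrite (_ : m%:Z + 1 = m.+1%:Z) //; lia.
rewrite (_ : Negz m + 1 = - m%:Z); last lia.
by rewrite (_ : Negz m = - m.+1%:Z) // !wactN ltrN2.
Qed.

(** This expresses that [w] is minimal in its left coset w W_J. *)
Definition incr J w := forall x y, x < y -> bl J x = bl J y -> wact w x < wact w y.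

Lemma wact_lt w x y : x < y -> wact w x < wact w y \/ wact w y < wact w x.
Proof.
move=> xy; case: (ltgtP (wact w x) (wact w y)) => [|| /wact_inj e]; [by left|by right|lia].
Qed.

Local Notation parab := (parab s).

Lemma s_parab J j : j \in J -> s j \in parab J.
Proof. by move=> jJ; rewrite mem_gen // imset_f. Qed.

Lemma bl_s J j x : j \in J -> bl J (sg j x) = bl J x.
Proof.
rewrite -inJ_ord => jJ.
have e : bl J j.+1%:Z = bl J j%:Z.
  by apply/eqP; have := bl_adj J j; rewrite jJ (_ : j%:Z + 1 = j.+1%:Z) //; lia.
have eN : bl J (- j.+1%:Z) = bl J (- j%:Z) by rewrite !blN e.
rewrite /sg; case: ifP => j0.
  move: e eN; have -> : j%:Z = 0 by lia.
  have -> : j.+1%:Z = 1 by lia.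
  by rewrite oppr0; case: eqP => [->|_]; [move=> -> ->|case: eqP => [-> -> ->|]].
by do !(case: eqP => [->|_] //).
Qed.

Lemma bl_stab1 J w : w \in parab J -> forall x, bl J (wact w x) = bl J x.
Proof.
move=> /gen_prodgP[m [c hc ->]]; elim/big_ind: _ => [x|u v Hu Hv x|l _ x].
- by rewrite wact1.
- by rewrite wactM Hu Hv.
- by have /imsetP[j jJ ->] := hc l; rewrite wact_s bl_s.
Qed.

Lemma bl_stab2 J w j : (forall x, bl J (wact w x) = bl J x) -> desc w j -> j \in J.
Proof.
move=> H d; rewrite -inJ_ord -(bl_adj J j); apply/eqP/le_anti/andP; split.
  rewrite -(H (j%:Z + 1)) -(H j%:Z) bl_mono // ltW //.
  by move: d; rewrite /desc (_ : j%:Z + 1 = j.+1%:Z) //; lia.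
by apply: bl_mono; lia.
Qed.

(** W_J is the stabilizer of the blocks. A descent of a block-preserving element joins two
    neighbours of one block, hence lies in [J], and can be stripped off. *)
Lemma parabP J w : reflect (forall x, bl J (wact w x) = bl J x) (w \in parab J).
Proof.
apply: (iffP idP) => [|H]; first exact: bl_stab1.
move: {2}(len w) (erefl (len w)) => m; elim: m w H => [|m IH] w H ew.
  by rewrite (len0 ew) group1.
have [j dj] : exists j, desc w j.
  by apply: desc_ex; apply/eqP => e1; move: ew; rewrite e1 len1.
have sj := s_parab (bl_stab2 H dj).
rewrite -(groupMr _ sj); apply: IH => [x|].
  by rewrite wactM H bl_stab1.
by have := len_desc dj; rewrite ew => -[].
Qed.

Local Notation longest := (longest s).

Lemma longestP J : longest J \in parab J /\
  forall w, w \in parab J -> (len w <= len (longest J))%N.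
Proof. by rewrite /Defs.longest; case: arg_maxnP => [|w wJ H]; rewrite ?group1. Qed.

Lemma bl_longest J x : bl J (wact (longest J) x) = bl J x.
Proof. by apply/parabP; case: (longestP J). Qed.

Lemma longest_desc J j : j \in J -> desc (longest J) j.
Proof.
move=> jJ; apply/negPn/negP => /len_ndesc e; have [h1 h2] := longestP J.
by have := h2 _ (groupM h1 (s_parab jJ)); rewrite e ltnn.
Qed.

(** Inside a block the images decrease from neighbour to neighbour; between blocks the order is kept
    because W_J preserves block numbers. *)
Lemma block_inv J w : w \in parab J -> (forall j, j \in J -> desc w j) ->
  forall x y, x < y -> (wact w y < wact w x) = (bl J x == bl J y).
Proof.
move=> /parabP H D x y xy; case: eqP => e.
  apply: (@chain_block J (fun a b => b < a)) e => //.
    by move=> a b c h h'; apply: lt_trans h' h.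
  by move=> z /inJP[j jJ ej]; rewrite desc_fidx ej D.
apply/negbTE; rewrite -leNgt ltW //; apply: (@bl_lt J); rewrite !H.
by have := bl_mono J (ltW xy); lia.
Qed.

Lemma longest_inv J x y : x < y ->
  (wact (longest J) y < wact (longest J) x) = (bl J x == bl J y).
Proof. by apply: block_inv; [case: (longestP J)|exact: longest_desc]. Qed.

Lemma longest_uniq J w :
  w \in parab J -> (forall j, j \in J -> desc w j) -> w = longest J.
Proof.
by move=> h1 h2; apply: inv_determined => x y xy; rewrite longest_inv // (block_inv h1 h2).
Qed.

Lemma longest_lt J x y : x < y -> bl J x <> bl J y ->
  wact (longest J) x < wact (longest J) y.
Proof.
by move=> xy e; case: (wact_lt (longest J) xy) => //; rewrite longest_inv // => /eqP.
Qed.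

Lemma longest_gt J x y : x < y -> bl J x = bl J y ->
  wact (longest J) y < wact (longest J) x.
Proof. by move=> xy e; rewrite longest_inv // e. Qed.

Lemma longestK J : (longest J * longest J)%g = 1%g.
Proof.
apply: inv_determined => x y xy; rewrite !wact1 !wactM [in RHS]ltNge (ltW xy) /=.
apply/negbTE; rewrite -leNgt ltW //; have [e|/eqP e] := eqVneq (bl J x) (bl J y).
  by apply: longest_gt; [apply: longest_gt|rewrite !bl_longest].
by apply: longest_lt; [apply: longest_lt|rewrite !bl_longest].
Qed.

Lemma longestV J : (longest J)^-1%g = longest J.
Proof. by apply: (mulgI (longest J)); rewrite mulgV longestK. Qed.

Lemma wact_longestK J x : wact (longest J) (wact (longest J) x) = x.
Proof. by rewrite -wactM longestK wact1. Qed.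

(** An integer strictly between the two images would lie in the same block, and the involution would
    carry it strictly between x and x + 1. *)
Lemma longest_adj M x : inJ M (fidx x) ->
  wact (longest M) x = wact (longest M) (x + 1) + 1.
Proof.
set f := wact (longest M); move=> Mx.
have e : bl M (x + 1) = bl M x by apply/eqP; rewrite bl_adj.
have lt : f (x + 1) < f x by apply: longest_gt; [lia|].
have [h|h] : f x = f (x + 1) + 1 \/ f (x + 1) + 1 < f x by lia.
  exact: h.
have eb : bl M (f (x + 1)) = bl M (f x) by rewrite !bl_longest.
have ey : bl M (f (x + 1) + 1) = bl M (f (x + 1)).
  by apply: (bl_between _ _ eb); lia.
have h1 : f (f (x + 1) + 1) < f (f (x + 1)) by apply: longest_gt; [lia|rewrite ey].
have h2 : f (f x) < f (f (x + 1) + 1) by apply: longest_gt; [lia|rewrite ey].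
by move: h1 h2; rewrite /f !wact_longestK; lia.
Qed.

Lemma longest_conj M j : j \in M -> exists i : 'I_n,
  [/\ i \in M, (longest M * s j = s i * longest M)%g &
      i = fidx (wact (longest M) (j%:Z + 1)) :> nat].
Proof.
move=> jM; have jM' : inJ M (fidx j) by rewrite inJ_ord.
have := longest_adj jM'; set y := wact _ (j%:Z + 1) => e.
have /inJP[i iM ei] : inJ M (fidx y).
  by rewrite -bl_adj -e /y !bl_longest eq_sym bl_adj.
exists i; split => //; apply: conj_s.
have ey : wact (longest M) j.+1 = y by rewrite /y (_ : j%:Z + 1 = j.+1%:Z) //; lia.
rewrite e ey -ei; case: (y) => m /=; first by constructor 2; lia.
by constructor 4; lia.
Qed.

End Blocks.

(** * Core cosets *)

Section Core.
Context {n : nat} {X : sysB n}.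
Implicit Types (u v w x y z : X) (a b : int) (i j : 'I_n) (t : seq 'I_n).
Local Notation s := (@gen n X).
Local Notation len := (len s).

Implicit Types (I J K M : {set 'I_n}).

Local Notation star := (star s).
Local Notation wprod := (wprod s).
Local Notation parab := (parab s).
Local Notation longest := (longest s).
Local Notation dcos_of := (dcos_of s).
Local Notation dcmax := (dcmax (s := s)).
Local Notation reduced := (reduced (s := s)).

Lemma incr_nocross J x u : incr J x -> u \in parab J -> nocross x u.
Proof.
move=> ix uJ a b ab lt; apply: ix => //; have /parabP H := uJ.
apply/eqP; rewrite !H eq_sym; apply/negPn/negP => ne.
move: lt; rewrite ltNge ltW //; apply: (@bl_lt n J); rewrite !H lt_neqAle ne.
exact: bl_mono (ltW ab).
Qed.

Lemma incr_len J x u : incr J x -> u \in parab J -> len (x * u)%g = (len x + len u)%N.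
Proof. by move=> ix uJ; apply/addP; apply: incr_nocross ix uJ. Qed.

(* The elements carrying the blocks of [J] increasingly onto blocks of [I]; their
   (I, J)-cosets are the composites of atomic ones. *)
Definition core I J (w : X) :=
  (forall a b, (bl I (wact w a) == bl I (wact w b)) = (bl J a == bl J b)) /\ incr J w.

Lemma core1 J : core J J 1%g.
Proof. by split=> [x y|x y xy _]; rewrite !wact1. Qed.

Lemma core_mul I J K u v : core I J u -> core J K v -> core I K (u * v)%g.
Proof.
move=> [bu iu] [bv iv]; split=> [x y|x y xy e]; first by rewrite !wactM bu bv.
by rewrite !wactM; apply: iu; [apply: iv|apply/eqP; rewrite bv e].
Qed.

Lemma coreV I J u : core I J u -> core J I u^-1%g.
Proof.
move=> [bu iu]; split=> [x y|x y xy e]; first by rewrite -bu !wactKV.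
case: (wact_lt u^-1%g xy) => // lt.
have := iu _ _ lt; rewrite !wactKV => h; have : y < x.
  by apply: h; apply/eqP; rewrite -bu !wactKV e.
by rewrite ltNge (ltW xy).
Qed.

Lemma core_conj I J x u : core I J x -> u \in parab J -> (x * u * x^-1)%g \in parab I.
Proof.
move=> [bx _] /parabP H; apply/parabP => a.
by rewrite -[in RHS](wactKV x a) !wactM; apply/eqP; rewrite bx H.
Qed.

Lemma dcos_core I J x z : core I J x ->
  (z \in dcval (dcos_of I J x)) = ((x^-1 * z)%g \in parab J).
Proof.
move=> cx; apply/idP/idP => /= [/mulsgP[_ u /rcosetP[v vI ->] uJ ->]|H].
  have := core_conj (coreV cx) vI; rewrite invgK => h.
  by rewrite !mulgA groupM.
by apply/mulsgP; exists x (x^-1 * z)%g; rewrite ?mulKVg ?rcoset_refl.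
Qed.

(** Both elements have the same inversions: none inside a block of [J], and between different blocks
    the order of the images is that of their block numbers in [I], which the factor from W_J leaves
    unchanged. *)
Lemma core_eq I J x x' : core I J x -> core I J x' ->
  dcos_of I J x = dcos_of I J x' -> x = x'.
Proof.
move=> cx cx' e; have : x' \in dcval (dcos_of I J x).
  by rewrite e dcos_core // mulVg group1.
rewrite dcos_core // => /parabP H; apply: inv_determined => a b ab.
have [e1|ne] := eqVneq (bl J a) (bl J b).
  by rewrite !ltNge !ltW //; [apply: cx'.2|apply: cx.2].
have lt : bl J a < bl J b by rewrite lt_neqAle ne bl_mono // ltW.
have e2 c : wact x' c = wact x (wact (x^-1 * x')%g c) by rewrite -wactM mulKVg.
have H' c c' : bl J c < bl J c' ->
    (wact x c' < wact x c) = (bl I (wact x c') < bl I (wact x c)).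
  move=> l; apply/idP/idP => [h|]; last exact: bl_lt.
  by rewrite lt_neqAle bl_mono ?ltW // andbT cx.1 gt_eqF.
rewrite H' // [in RHS]e2 [in RHS]e2 H' ?H //.
have E c : bl I (wact x (wact (x^-1 * x')%g c)) = bl I (wact x c).
  by apply/eqP; rewrite cx.1 H.
by rewrite !E.
Qed.

Lemma core_len I J x u : core I J x -> u \in parab J ->
  len (x * u)%g = (len x + len u)%N.
Proof. by move=> cx; apply: incr_len cx.2. Qed.

Lemma bruhat_len u v : bruhat s u v -> u = v \/ (len u < len v)%N.
Proof.
case/connectP => p; elim: p u => [|z p IH] u /=; first by left.
move=> /andP[/andP[_ lt] pz] e; right.
by case: (IH z pz e) => [<-//|]; apply: ltn_trans.
Qed.

Lemma bruhat_s u j : ~~ desc u j -> bruhat s u (u * s j)%g.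
Proof.
move=> nd; apply: connect1; rewrite mulKg len_ndesc // ltnSn andbT.
by apply/imset2P; exists j 1%g; rewrite // conjg1.
Qed.

(** As long as [u] has an ascent in [J], multiplying by it raises x u in Bruhat order; the climb
    ends at the longest element. The induction is on the missing length. *)
Lemma bruhat_core I J x u : core I J x -> u \in parab J ->
  bruhat s (x * u)%g (x * longest J)%g.
Proof.
move=> cx; move: {2}(len (longest J) - len u)%N (leqnn (len (longest J) - len u)) => m.
elim: m u => [|m IH] u le uJ.
all: have [/forall_inP H|] := boolP [forall j in J, desc u j].
1,3: by rewrite (longest_uniq uJ H); apply: connect0.
all: rewrite negb_forall_in => /exists_inP[j jJ nd].
all: have := (longestP (X := X) J).2 _ (groupM uJ (s_parab jJ)); rewrite len_ndesc // => le'.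
  by lia.
apply: (@connect_trans _ _ (x * u * s j)%g); last first.
  by rewrite -mulgA; apply: IH; rewrite ?groupM ?s_parab // len_ndesc //; lia.
apply: bruhat_s; apply/negP => /len_desc.
rewrite -mulgA !(core_len cx) ?groupM ?s_parab // len_ndesc //; lia.
Qed.

Lemma dcmax_core I J x : core I J x -> dcmax (dcos_of I J x) = (x * longest J)%g.
Proof.
move=> cx; rewrite /Defs.dcmax.
have xin : (x * longest J)%g \in dcval (dcos_of I J x).
  by rewrite dcos_core // mulKg; case: (longestP (X := X) J).
have xmax z : z \in dcval (dcos_of I J x) -> bruhat s z (x * longest J)%g.
  by rewrite dcos_core // => h; rewrite -(mulKVg x z); apply: bruhat_core cx h.
case: pickP => [w /andP[wd /forall_inP H]|]; last first.
  by move=> /(_ (x * longest J)%g); rewrite xin /= => /negP[]; apply/forall_inP.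
have [//|l1] := bruhat_len (xmax _ wd); have [//|l2] := bruhat_len (H _ xin).
by have := ltn_trans l1 l2; rewrite ltnn.
Qed.

Lemma reduced_word_parab J t : size t = len (wprod t) -> wprod t \in parab J ->
  forall i, i \in t -> i \in J.
Proof.
elim/last_ind: t => [//|t j IH]; rewrite size_rcons -cats1 wprod_cat wprod_cons wprod_nil mulg1.
move=> e wJ; have h1 := @len_min n X t; have dj : desc (wprod t * s j)%g j.
  by rewrite descE sKr -e ltnS.
have jJ : j \in J by apply: bl_stab2 dj; apply/parabP.
have lt : size t = len (wprod t) by have := len_desc dj; rewrite sKr -e => -[].
have wt : wprod t \in parab J by move: wJ; rewrite groupMr // s_parab.
by move=> i; rewrite mem_cat mem_seq1 => /orP[/(IH lt wt)|/eqP->].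
Qed.

(** Neighbours in a block of [J] are carried by y^-1 increasingly into one block of [K] and then
    reversed by w_K. Hence each element of [J] is a left descent of y w_K and every letter of w_J is
    absorbed. *)
Lemma star_longest J K y : core J K y ->
  star (longest J) (y * longest K)%g = (y * longest K)%g.
Proof.
move=> cy; have [e1 e2] := redwordP (longest J); apply: foldr_star1_absorb => i.
move=> /(@reduced_word_parab J) iJ; have {}iJ : i \in J.
  by apply: iJ; rewrite e2 ?e1 //; case: (longestP (X := X) J).
have e : (bl J i.+1%:Z == bl J i%:Z) = (i \in J).
  by rewrite -inJ_ord -(bl_adj J i%:Z) (_ : i.+1%:Z = i%:Z + 1) //; lia.
rewrite /desc invMg longestV !wactM; apply: longest_gt.
  by apply: (coreV cy).2; [lia|apply/eqP; rewrite eq_sym e].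
by apply/eqP; rewrite (coreV cy).1 eq_sym e.
Qed.

Lemma core_star I J K x y : core I J x -> core J K y ->
  star (x * longest J)%g (y * longest K)%g = star x (y * longest K)%g.
Proof.
move=> cx cy; rewrite star_mul; first by rewrite (star_longest cy).
by apply: core_len cx _; case: (longestP (X := X) J).
Qed.

(** Removing w_J from the maximal element x w_J leaves x, so the condition asks that x and y w_K
    multiply with additive length; the common summand from w_K then drops out. *)
Lemma core_reduced I J K x y : core I J x -> core J K y ->
  reduced (dcos_of I J x) (dcos_of J K y) = (len (x * y)%g == (len x + len y)%N).
Proof.
move=> cx cy; rewrite /Defs.reduced !dcmax_core // (core_star cx cy) mulgK.
have lJ := (longestP (X := X) J).1; have lK := (longestP (X := X) K).1.
rewrite (core_len cx lJ) (core_len cy lK) -wmulA.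
have h := core_len (core_mul cx cy) lK; have h' := core_len cy lK.
apply/andP/eqP => [[/eqP -> /eqP]|e]; first by rewrite h; lia.
have -> : star x (y * longest K)%g = (x * y * longest K)%g.
  by rewrite star_add -wmulA // h e h' addnA.
by rewrite h e; split=> //; apply/eqP; lia.
Qed.

Lemma core_dcstar I J K x y : core I J x -> core J K y ->
  len (x * y)%g = (len x + len y)%N ->
  dcstar (dcos_of I J x) (dcos_of J K y) = dcos_of I K (x * y)%g.
Proof.
move=> cx cy e; rewrite /dcstar !dcmax_core // (core_star cx cy).
have lK := (longestP (X := X) K).1; have cxy := core_mul cx cy.
rewrite star_add; last by rewrite -wmulA (core_len cxy lK) e (core_len cy lK) addnA.
rewrite -wmulA; apply: val_inj => /=.
(* Conjugation by xy moves the factor w_K into W_I, where the coset absorbs it. *)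
have lI := core_conj cxy lK.
rewrite -[in LHS](mulgKV (x * y)%g (x * y * longest K)%g) rcosetM.
by rewrite (rcoset_id lI).
Qed.

End Core.

(** * Block permutations and atomic cosets *)

Section Inflation.
Context {n : nat} {X : sysB n}.
Implicit Types (u v w : X) (x y : int) (i j : 'I_n) (t : seq 'I_n).
Local Notation s := (@gen n X).

Implicit Types (I J K M : {set 'I_n}).

Local Notation longest := (longest s).

(* [w] carries the blocks of [J] to those of [I] as [f] permutes their numbers. *)
Definition infl I J (f : int -> int) (w : X) :=
  (forall x, bl I (wact w x) = f (bl J x)) /\ incr J w.

Lemma infl1 J : infl J J id 1%g.
Proof. by split=> [x|x y xy _]; rewrite !wact1. Qed.

Lemma infl_core I J f w : injective f -> infl I J f w -> core I J w.
Proof. by move=> fI [bf iw]; split=> // x y; rewrite !bf (inj_eq fI). Qed.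

Lemma infl_mul I J K f g u v :
  infl I J f u -> infl J K g v -> infl I K (f \o g) (u * v)%g.
Proof.
move=> [bu iu] [bv iv]; split=> [x|x y xy e]; first by rewrite wactM bu bv.
by rewrite !wactM; apply: iu; [apply: iv|rewrite !bv e].
Qed.

Lemma infl_inv I J f w : infl I J f w -> injective f ->
  forall x y, x < y -> (wact w y < wact w x) = (f (bl J y) < f (bl J x)).
Proof.
move=> [bw iw] fI x y xy; rewrite -!bw; have [e|ne] := eqVneq (bl J x) (bl J y).
  by rewrite !bw e ltxx ltNge ltW // iw.
apply/idP/idP => [h|]; last exact: bl_lt.
rewrite lt_neqAle bl_mono ?ltW // andbT !bw.
by apply: contra_neq ne => /fI.
Qed.

Lemma infl_uniq I I' J f w w' : injective f ->
  infl I J f w -> infl I' J f w' -> w = w' /\ I = I'.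
Proof.
move=> fI h h'; have e : w = w'.
  by apply: inv_determined => x y xy; rewrite (infl_inv h) // (infl_inv h').
split=> //; apply: bl_inj => x; rewrite -(wactKV w x) h.1.
by rewrite e h'.1.
Qed.

Lemma infl_det I J f g w : infl I J f w -> infl I J g w -> f =1 g.
Proof. by move=> [h _] [h' _] p; have [x <-] := bl_surj J p; rewrite -h -h'. Qed.

Lemma bn_total J : bn J n = #|~: J|.
Proof.
rewrite /bn -sum1_card [RHS]big_mkcond /=; apply: eq_bigr => i _.
by rewrite inJ_ord inE; case: (_ \in _).
Qed.

Lemma bl_nat J (m : nat) : bl J m%:Z = (bn J m)%:Z. Proof. by []. Qed.

Lemma bn_lt J (d : 'I_n) (m : nat) : d \notin J -> (bn J d < bn J m)%N = (d < m)%N.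
Proof.
move=> dJ; have := bnS J d; rewrite inJ_ord dJ /= => e; apply/idP/idP.
  by rewrite -!ltz_nat -!bl_nat => /bl_lt.
by move=> dm; rewrite -addn1 -e -lez_nat -!bl_nat bl_mono.
Qed.

Lemma enum_val_lt (A : {set 'I_n}) (i j : 'I_#|A|) :
  (i < j)%N -> (enum_val i < enum_val j)%N.
Proof.
move=> ij; rewrite (enum_val_nth (enum_val i)).
rewrite [X in (_ < nat_of_ord X)%N](enum_val_nth (enum_val i)).
have so : sorted (fun a b : 'I_n => (a < b)%N) (enum A).
  rewrite /enum_mem; apply: sorted_filter; first by move=> a b c; apply: ltn_trans.
  have := @sorted_map _ _ (val : 'I_n -> nat) ltn (enum 'I_n).
  by rewrite val_enum_ord iota_ltn_sorted enumT => <-.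
have tr : transitive (fun a b : 'I_n => (a < b)%N) by move=> a b c; apply: ltn_trans.
by apply: (sorted_ltn_nth tr _ so) => //; rewrite inE -cardE.
Qed.

Lemma incr_ord_id k (f : 'I_k -> nat) :
    (forall l m : 'I_k, (l < m)%N -> (f l < f m)%N) -> (forall l, (f l < k)%N) ->
  forall l, f l = l.
Proof.
move=> fS fk.
have lo m (h : (m < k)%N) : (m <= f (Ordinal h))%N.
  elim: m h => // m IH h; have h' : (m < k)%N by apply: ltnW.
  by apply: leq_ltn_trans (IH h') _; apply: fS => /=.
have hi m (h : (k - m.+1 < k)%N) : (m < k)%N -> (f (Ordinal h) <= k - m.+1)%N.
  elim: m h => [|m IH] h lt.
    by have := fk (Ordinal h); move: (f _) => a; clear fk fS lo; lia.
  have h' : (k - m.+1 < k)%N by clear IH; lia.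
  have := IH h' (ltnW lt); have : (f (Ordinal h) < f (Ordinal h'))%N.
    by apply: fS => /=; clear -lt; lia.
  by move: (f (Ordinal h)) (f (Ordinal h')) => a b; clear -lt; lia.
move=> l; have lk := ltn_ord l; apply/eqP; rewrite eqn_leq; apply/andP; split.
  have h : (k - (k - l.+1).+1 < k)%N by lia.
  have e : Ordinal h = l by apply: val_inj => /=; lia.
  have lt : (k - l.+1 < k)%N by lia.
  by have := hi _ h lt; rewrite e; move: (f l) => a; clear -lk; lia.
by have := lo l lk; rewrite (_ : Ordinal _ = l) //; apply: val_inj.
Qed.

(** Thus the generator with index d_i joins the blocks i and i + 1. The map from i to the block
    number of d_i is strictly increasing into [0, k), hence the identity. *)
Lemma bn_enum_val J (i : 'I_#|~: J|) : bn J (enum_val i) = i.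
Proof.
have lt (l : 'I_#|~: J|) m : (bn J (enum_val l) < bn J m)%N = (enum_val l < m)%N.
  by rewrite bn_lt //; have := enum_valP l; rewrite inE.
have h1 (l m : 'I_#|~: J|) : (l < m)%N -> (bn J (enum_val l) < bn J (enum_val m))%N.
  by move=> lm; rewrite lt enum_val_lt.
have h2 (l : 'I_#|~: J|) : (bn J (enum_val l) < #|~: J|)%N by rewrite -bn_total lt.
exact: incr_ord_id h1 h2 i.
Qed.

(** Renumbering of the blocks when i and i + 1, and likewise their negatives, are joined; for [i] =
    0 the blocks -1, 0 and 1 become one. *)
Definition merge (i : nat) (p : int) : int :=
  if i%:Z < p then p - 1 else if p < - i%:Z then p + 1 else p.

Lemma sg_merge (i : nat) p q : p <= q ->
  (sg i q < sg i p) = (merge i p == merge i q) && (p != q).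
Proof. rewrite /merge; sgl. Qed.

Lemma bl_setU1 J (d : 'I_n) x : d \notin J -> bl (d |: J) x = merge (bn J d) (bl J x).
Proof.
move=> dJ; have H m : bn J m = (bn (d |: J) m + (d < m))%N.
  elim: m => [|m IH]; first by rewrite /bn !big_ord0.
  rewrite !bnS IH; have [em|nm] := eqVneq m d.
    by rewrite em !inJ_ord !inE eqxx dJ ltnn ltnSn; lia.
  have -> : inJ (d |: J) m = inJ J m.
    apply/existsP/existsP => -[e /andP[]]; rewrite ?inE => h /eqP em; exists e.
      by move: h; rewrite -val_eqE /= em (negbTE nm) eqxx andbT.
    by rewrite inE h orbT em eqxx.
  by move: nm; clear IH; case: (inJ J m); lia.
rewrite /merge; case: x => m /=.
  by have := bn_lt m dJ; rewrite (H m); case: ltnP; ifs; lia.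
by have := bn_lt m.+1 dJ; rewrite (H m.+1); case: (ltnP d m.+1); ifs; lia.
Qed.

(** * The block permutation of an atomic coset *)

Section Atomic.
Variables (J : {set 'I_n}) (i : 'I_#|~: J|).
Local Notation d := (enum_val i).
Local Notation M := (atop i).
Local Notation I := (atarget s i).
Local Notation v := (longest M * longest J)%g.

Lemma atomic_notin : d \notin J.
Proof. by have := enum_valP i; rewrite inE. Qed.

Lemma bl_atop x : bl M x = merge i (bl J x).
Proof. by rewrite bl_setU1 ?atomic_notin // bn_enum_val. Qed.

Lemma bl_atop_longest x : bl M (wact (longest J) x) = bl M x.
Proof. by rewrite !bl_atop bl_longest. Qed.

(** A pair in one block of [J] is reversed twice and a pair in different blocks of [M] never. What
    remains inverted are the pairs from different blocks of [J] that are joined in [M], and by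
    [sg_merge] these are the pairs whose numbers [sg i] reverses. *)
Lemma atomic_inv x y : x < y ->
  (wact v y < wact v x) = (sg i (bl J y) < sg i (bl J x)).
Proof.
move=> xy; rewrite sg_merge ?bl_mono ?ltW // -!bl_atop !wactM.
have [e|/eqP ne] := eqVneq (bl J x) (bl J y).
  rewrite andbF ltNge ltW //; apply: longest_gt; first exact: longest_gt.
  by rewrite !bl_atop_longest !bl_atop e.
by rewrite andbT longest_inv ?bl_atop_longest //; apply: longest_lt.
Qed.

Lemma atomic_incr : incr J v.
Proof.
move=> x y xy e; case: (wact_lt v xy) => //.
by rewrite atomic_inv // e ltxx.
Qed.

(** Conjugation by w_M permutes the generators of [M] and takes those of [I] to those of [J], since
    the one left out of [I] is the conjugate of s_d. *)
Lemma inJ_atarget (m : nat) :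
  inJ I m = (bl J (wact (longest M) m.+1%:Z) == bl J (wact (longest M) m%:Z)).
Proof.
have e1 : m.+1%:Z = m%:Z + 1 by lia.
have [/inJP[j jM ->]|nM] := boolP (inJ M m); last first.
  have -> : inJ I m = false.
    apply: contraNF nM => /inJP[j]; rewrite inE => /andP[jM _] ->.
    by rewrite inJ_ord.
  apply/esym; apply: contraNF nM => /eqP e.
  rewrite -[m](_ : fidx m%:Z = m) // -bl_adj -e1 -(bl_longest (X := X)).
  by rewrite -(bl_longest (X := X) M m) !bl_atop e.
have [k [kM ek fk]] := longest_conj (X := X) jM; rewrite inJ_ord inE jM /=.
have jM' : inJ M (fidx j) by rewrite inJ_ord.
have := longest_adj (X := X) jM'; rewrite (_ : j.+1%:Z = j%:Z + 1); last lia.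
move: fk; set y := wact _ (j%:Z + 1) => fk ->.
rewrite [RHS]eq_sym bl_adj -fk inJ_ord.
have kJ : (k \in J) = (k != d).
  move: kM; rewrite inE in_set1; case: eqP => [->|_ /= ->] // _.
  by rewrite (negbTE atomic_notin).
rewrite kJ -(inj_eq (@s_inj n X)); congr negb; apply/eqP/eqP => e.
  apply: (mulIg (longest M)); rewrite -ek e.
  by rewrite !mulgA longestK mul1g.
by apply: (mulgI (longest M)); rewrite ek e !mulgA longestK mul1g.
Qed.

(* Both sides are odd, monotone and onto, so it is enough to compare where they
   are locally constant. *)
Lemma atomic_infl : infl I J (sg i) v.
Proof.
pose f x := sg i (bl J (wact v^-1%g x)).
have fE x : f (wact v x) = sg i (bl J x) by rewrite /f wactVK.
suff H : f =1 bl I by split; [move=> x; rewrite -H fE|exact: atomic_incr].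
apply: bl_unique => [x|x y|p|m].
- by rewrite /f wactN blN sgN.
- rewrite le_eqVlt => /orP[/eqP-> //|].
  rewrite -(wactKV v x) -(wactKV v y) !fE.
  set a := wact v^-1%g x; set b := wact v^-1%g y => lt.
  case: (ltgtP a b) => [ab|ba|->//].
    by rewrite leNgt -atomic_inv // -leNgt ltW.
  by rewrite ltW // -atomic_inv.
- by have [x e] := bl_surj J (sg i p); exists (wact v x); rewrite fE e sgK.
rewrite inJ_atarget /f (can_eq (sgK i)) invMg !longestV !wactM !bl_longest.
by [].
Qed.

Lemma atomic_coset_core : atomic_coset s i = dcos_of s I J v.
Proof.
apply: val_inj; rewrite /= -!mulgA; congr (_ * _)%g.
apply/setP => z; apply/mulsgP/mulsgP => -[_ u /set1P-> uJ ->].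
  exists v (longest J * u)%g; rewrite ?inE ?groupM //; first by case: (longestP (X := X) J).
  by rewrite -mulgA (mulgA (longest J)) longestK mul1g.
exists (longest M) (longest J * u)%g; rewrite ?inE ?groupM ?mulgA //.
by case: (longestP (X := X) J).
Qed.

End Atomic.

End Inflation.

Lemma infl_len (n k : nat) (X : sysB n) (Y : sysB k) (I J K : {set 'I_n})
    (x y : X) (u v : Y) :
    infl I J (wact u) x -> infl J K (wact v) y ->
  (len (@gen n X) (x * y)%g == (len (@gen n X) x + len (@gen n X) y)%N) =
  (len (@gen k Y) (u * v)%g == (len (@gen k Y) u + len (@gen k Y) v)%N).
Proof.
move=> hx hy; suff H : nocross x y <-> nocross u v.
  apply/eqP/eqP => /addP h; apply/addP; exact/H.
have iv := infl_inv hy (@wact_inj k Y v); have [bx _] := hx; have [by_ _] := hy.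
split=> nc.
  move=> p q; have [a <-] := bl_surj K p; have [b <-] := bl_surj K q => pq.
  have ab := bl_lt pq; rewrite -iv // -!by_ -!bx => lt.
  rewrite lt_neqAle bl_mono ?ltW ?nc // andbT !bx !by_.
  by rewrite !(inj_eq (@wact_inj k Y _)) gt_eqF.
move=> a b ab lt; have := lt; rewrite iv // => lt'.
have pq : bl K a < bl K b.
  rewrite lt_neqAle bl_mono ?ltW // andbT; apply: contraTneq lt' => ->.
  by rewrite ltxx.
by apply: (@bl_lt n I); rewrite !bx !by_; apply: nc.
Qed.

(** * The subcategory of atomic cosets *)

Section Linear.
Context {n : nat} {X : sysB n}.
Implicit Types (u v w : X) (x y : int) (i j : 'I_n) (t : seq 'I_n).
Local Notation s := (@gen n X).
Local Notation len := (len s).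

Implicit Types (I J K M : {set 'I_n}).

Local Notation dcos_of := (dcos_of s).
Local Notation D := (Dcat s).

Lemma dcompDl K J I (f g : @hom D J I) (h : @hom D K J) :
  comp (f + g) h = comp f h + comp g h.
Proof.
rewrite /= /dcomp -big_split; apply: eq_bigr => p _ /=.
rewrite -big_split; apply: eq_bigr => q _ /=.
by rewrite ffunE mulrDl mulrzDr.
Qed.

Lemma dcompDr K J I (f : @hom D J I) (g h : @hom D K J) :
  comp f (g + h) = comp f g + comp f h.
Proof.
rewrite /= /dcomp -big_split; apply: eq_bigr => p _ /=.
rewrite -big_split; apply: eq_bigr => q _ /=.
by rewrite ffunE mulrDr mulrzDr.
Qed.

Lemma dcomp0l K J I (h : @hom D K J) : comp (0 : @hom D J I) h = 0.
Proof. by apply: (addrI (comp 0 h)); rewrite -dcompDl !addr0. Qed.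

Lemma dcomp0r K J I (f : @hom D J I) : comp f (0 : @hom D K J) = 0.
Proof. by apply: (addrI (comp f 0)); rewrite -dcompDr !addr0. Qed.

Lemma dcompBl K J I (f g : @hom D J I) (h : @hom D K J) :
  comp (f - g) h = comp f h - comp g h.
Proof. by apply: (addIr (comp g h)); rewrite -dcompDl !subrK. Qed.

Lemma dcompBr K J I (f : @hom D J I) (g h : @hom D K J) :
  comp f (g - h) = comp f g - comp f h.
Proof. by apply: (addIr (comp f h)); rewrite -dcompDr !subrK. Qed.

Lemma dcomp_basis I J K (p : dcos s I J) (q : dcos s J K) :
  @comp D K J I (dbasis p) (dbasis q) =
  if reduced p q then dbasis (dcstar p q) else 0.
Proof.
rewrite /= /dcomp (bigD1 p) //= [X in _ + X]big1 ?addr0 => [|p' /negbTE np].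
  rewrite big_mkcond (bigD1 q) //= [X in _ + X]big1 ?addr0 => [|q' /negbTE nq].
    by rewrite !ffunE !eqxx mulr1 mulr1z.
  by rewrite !ffunE nq mulr0 mulr0z if_same.
by apply: big1 => q' _; rewrite ffunE np mul0r mulr0z.
Qed.

Definition bas I J (w : X) : @hom D J I := dbasis (dcos_of I J w).

Lemma core_comp I J K u v : core I J u -> core J K v ->
  comp (bas I J u) (bas J K v) =
  if len (u * v)%g == (len u + len v)%N then bas I K (u * v)%g else 0.
Proof.
move=> cu cv; rewrite /bas dcomp_basis (core_reduced cu cv).
by case: eqP => // e; rewrite core_dcstar.
Qed.

(** Contains all generated morphisms. On it composition is multiplication in the group, cut off to 0
    where lengths do not add, so the category laws can be checked on single group elements. *)
Inductive spanned I J : @hom D J I -> Prop :=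
| span0 : spanned 0
| spanB f g : spanned f -> spanned g -> spanned (f - g)
| spanE w : core I J w -> spanned (bas I J w).

Lemma spanned_comp I J K (f : @hom D J I) (g : @hom D K J) :
  spanned f -> spanned g -> spanned (comp f g).
Proof.
elim=> [|f1 f2 _ IH1 _ IH2|u cu] sg; first by rewrite dcomp0l; constructor.
  by rewrite dcompBl; constructor; [apply: IH1|apply: IH2].
elim: sg => [|g1 g2 _ IH1 _ IH2|v cv]; first by rewrite dcomp0r; constructor.
  by rewrite dcompBr; constructor.
rewrite core_comp //; case: ifP => _; constructor.
exact: core_mul cu cv.
Qed.

Lemma spanned_assoc I J K L (f : @hom D J I) (g : @hom D K J) (h : @hom D L K) :
  spanned f -> spanned g -> spanned h -> comp f (comp g h) = comp (comp f g) h.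
Proof.
elim=> [|f1 f2 _ IH1 _ IH2|u cu] sg sh; first by rewrite !dcomp0l.
  by rewrite !dcompBl IH1 // IH2.
elim: sg => [|g1 g2 _ IH1 _ IH2|v cv]; first by rewrite dcomp0l !dcomp0r dcomp0l.
  by rewrite dcompBl !dcompBr dcompBl IH1 IH2.
elim: sh => [|h1 h2 _ IH1 _ IH2|w cw]; first by rewrite !dcomp0r.
  by rewrite !dcompBr IH1 IH2.
rewrite (core_comp cv cw) (core_comp cu cv).
have l1 := len_mul u v; have l2 := len_mul v w; have l3 := len_mul (u * v) w.
have l4 := len_mul u (v * w); have e : (u * v * w)%g = (u * (v * w))%g by rewrite mulgA.
rewrite e in l3.
(* Either bracketing is nonzero exactly when the length of uvw is the sum of the three lengths. *)
case: eqP => h1; case: eqP => h2; rewrite ?dcomp0l ?dcomp0r //.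
- rewrite (core_comp cu (core_mul cv cw)) (core_comp (core_mul cu cv) cw) e.
  by congr (if _ then _ else _); apply/eqP/eqP; lia.
- rewrite (core_comp cu (core_mul cv cw)); case: eqP => // h3; exfalso; lia.
- rewrite (core_comp (core_mul cu cv) cw) e; case: eqP => // h3; exfalso; lia.
Qed.

Lemma spanned_id J : @idm D J = bas J J 1%g.
Proof. by []. Qed.

Lemma spanned_comp1 I J (f : @hom D J I) : spanned f -> comp (@idm D I) f = f.
Proof.
rewrite spanned_id; elim=> [|f1 f2 _ IH1 _ IH2|u cu]; first by rewrite dcomp0r.
  by rewrite dcompBr IH1 IH2.
by rewrite (core_comp (core1 I) cu) mul1g len1 eqxx.
Qed.

Lemma spanned_1comp I J (f : @hom D J I) : spanned f -> comp f (@idm D J) = f.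
Proof.
rewrite spanned_id; elim=> [|f1 f2 _ IH1 _ IH2|u cu]; first by rewrite dcomp0l.
  by rewrite dcompBl IH1 IH2.
by rewrite (core_comp cu (core1 J)) mulg1 len1 addn0 eqxx.
Qed.

Lemma atomic_bas J (i : 'I_#|~: J|) :
  atomic s i = bas (atarget s i) J (longest s (atop i) * longest s J)%g.
Proof. by rewrite /atomic atomic_coset_core. Qed.

Lemma atomic_core J (i : 'I_#|~: J|) :
  core (atarget s i) J (longest s (atop i) * longest s J)%g.
Proof. by apply: infl_core (atomic_infl i); apply: can_inj (sgK i). Qed.

Lemma generated_spanned J I (f : @hom D J I) :
  generated (@is_atomic X n s) f -> spanned f.
Proof.
elim=> {J I f} [_ _ _ [J i]|J|K J I f g _ sf _ sg|J I|J I f g _ sf _ sg].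
- by rewrite atomic_bas; constructor; apply: atomic_core.
- by rewrite spanned_id; constructor; apply: core1.
- exact: spanned_comp.
- exact: span0.
- exact: spanB.
Qed.

Lemma subhom_spanned (J I : ADcat s) (f : hom J I) : spanned (subval f).
Proof. by apply: generated_spanned; apply/asboolP; exact: (subvalP f). Qed.

Lemma ADcat_is_lincat : is_lincat (ADcat s).
Proof.
split=> /=.
- by move=> L K J I f g h; apply: val_inj; apply: spanned_assoc; apply: subhom_spanned.
- by move=> J I f; apply: val_inj; apply: spanned_comp1; apply: subhom_spanned.
- by move=> J I f; apply: val_inj; apply: spanned_1comp; apply: subhom_spanned.
- by move=> K J I f g h; apply: val_inj; apply: dcompDl.
- by move=> K J I f g h; apply: val_inj; apply: dcompDr.
Qed.

End Linear.

(** * Subsets and compositions *)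

Section Objects.
Context {n : nat}.
Implicit Types (I J : {set 'I_n}) (a b : 'I_n.+1).

Definition cnt J (l : nat) : nat := \sum_(a < n.+1) (bn J a == l).

Definition psum J (l : nat) : nat := \sum_(a < n.+1) (bn J a < l)%N.

Lemma psumS J l : psum J l.+1 = (psum J l + cnt J l)%N.
Proof.
rewrite /psum /cnt -big_split; apply: eq_bigr => a _ /=.
by rewrite ltnS leq_eqVlt addnC; case: ltngtP.
Qed.

Lemma psumE J l : psum J l = sumn (mkseq (cnt J) l).
Proof.
elim: l => [|l IH]; first by rewrite /psum big1.
by rewrite psumS IH mkseqS sumn_rcons.
Qed.

Lemma bn_mono J l m : (l <= m)%N -> (bn J l <= bn J m)%N.
Proof. by move=> lm; rewrite -lez_nat -!(bl_nat J) bl_mono. Qed.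

Lemma interval_card N p q : (p <= q)%N ->
  (\sum_(a < N) ((p <= a) && (a < q)) = minn N q - minn N p)%N.
Proof.
move=> pq; elim: N => [|N IH]; first by rewrite big_ord0; lia.
rewrite big_ord_recr /= IH; clear IH; lia.
Qed.

Lemma psum_le J (m : nat) : (m <= n)%N -> (psum J (bn J m) <= m)%N.
Proof.
move=> mn; have := interval_card n.+1 (leq0n m).
have -> : (minn n.+1 m - minn n.+1 0 = m)%N by lia.
move=> {2}<-; apply: leq_sum => a _; rewrite leq0n /=.
by case: (ltnP a m) => [_|/(bn_mono J) h]; [exact: leq_b1|rewrite ltnNge h].
Qed.

Lemma psum_gt J (m : nat) : (m <= n)%N -> (m < psum J (bn J m).+1)%N.
Proof.
move=> mn; have := interval_card n.+1 (leq0n m.+1).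
have -> : (minn n.+1 m.+1 - minn n.+1 0 = m.+1)%N by lia.
move=> <-; apply: leq_sum => a _; rewrite leq0n /= !ltnS.
by case: (leqP a m) => // /(bn_mono J) ->.
Qed.

Lemma psum_mono J l m : (l <= m)%N -> (psum J l <= psum J m)%N.
Proof.
move=> /subnKC <-; elim: (m - l)%N => [|r IH]; first by rewrite addn0.
by rewrite addnS psumS (leq_trans IH) ?leq_addr.
Qed.

Lemma psum_unique J (m l : nat) : (m <= n)%N ->
  (psum J l <= m < psum J l.+1)%N -> bn J m = l.
Proof.
move=> mn /andP[h1 h2]; have h3 := psum_le J mn; have h4 := psum_gt J mn.
case: (ltngtP (bn J m) l) => // lt.
  by have := psum_mono J lt; lia.
by have := psum_mono J lt; lia.
Qed.

Lemma bn_max J a : (bn J a <= #|~: J|)%N.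
Proof. by rewrite -bn_total bn_mono // -ltnS ltn_ord. Qed.

Lemma bn_hit J l : (l <= #|~: J|)%N -> exists2 a : 'I_n.+1,
  bn J a = l & forall b, bn J b = l -> (a <= b)%N.
Proof.
move=> lk; have ex : exists m, (l <= bn J m)%N by exists n; rewrite bn_total.
case: (ex_minnP ex) => m lm mmin.
have mn : (m < n.+1)%N by rewrite ltnS mmin // bn_total.
exists (Ordinal mn) => /=; last by move=> b e; apply: mmin; rewrite e.
apply/eqP; rewrite eqn_leq lm andbT; case: m {mn} mmin lm => [|m] mmin lm.
  by rewrite /bn big_ord0.
have := mmin m; rewrite bnS ltnn => h; case: leqP h lm => [_ /(_ isT)//|h _].
by rewrite bnS; move: h; case: (~~ _) => /=; lia.
Qed.

Lemma cnt_gt0 J l : (l <= #|~: J|)%N -> (0 < cnt J l)%N.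
Proof.
by move=> /bn_hit[a e _]; rewrite /cnt (bigD1 a) //= e eqxx.
Qed.

Lemma psum_total J : psum J #|~: J|.+1 = n.+1.
Proof.
rewrite /psum (eq_bigr (fun=> 1%N)) ?sum1_card ?card_ord // => a _.
by rewrite ltnS bn_max.
Qed.

Lemma adjacent_sym J : symmetric (adjacent J).
Proof.
by move=> a b; apply: eq_existsb => j; congr (_ && _); rewrite orbC.
Qed.

Lemma adjacent_bn J a b : adjacent J a b -> bn J a = bn J b.
Proof.
case/exists_inP => j jJ /orP[] /andP[/eqP -> /eqP ->];
  by rewrite bnS inJ_ord jJ addn0.
Qed.

Lemma connect_bn J a b : connect (adjacent J) a b = (bn J a == bn J b).
Proof.
apply/idP/eqP => [/connectP[p]|].
  elim: p a => [a _ ->//|c p IH] a /= /andP[/adjacent_bn -> pc] e.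
  exact: IH.
wlog ab : a b / (a <= b)%N => [H|].
  case: (leqP a b) => [|/ltnW ba e]; first exact: H.
  by rewrite (sym_connect_sym (adjacent_sym J)) H.
have [m em] : exists m, b = (a + m)%N :> nat by exists (b - a)%N; lia.
elim: m b em {ab} => [|m IH] b em e.
  by rewrite (_ : a = b) ?connect0 //; apply: val_inj; rewrite /= em addn0.
have cn : (a + m < n.+1)%N by have := ltn_ord b; clear IH; lia.
have l1 := @bn_mono J a (a + m) (leq_addr _ _).
have l2 := @bn_mono J (a + m) b; rewrite em in l2 e; have {}l2 := l2 ltac:(lia).
have e1 : bn J (a + m) = bn J a by lia.
apply: (connect_trans (IH (Ordinal cn) erefl (esym e1))); apply: connect1.
move: e; rewrite addnS bnS e1; case E: (inJ J (a + m)%N) => /=; last by lia.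
have [j jJ ej] := inJP E => _; apply/exists_inP; exists j => //=.
by rewrite em ej addnS ej !eqxx.
Qed.

Lemma card_class J a : #|class J a| = cnt J (bn J a).
Proof.
rewrite /cnt -sum1_card [LHS]big_mkcond /=; apply: eq_bigr => b _.
by rewrite inE connect_bn eq_sym; case: eqP.
Qed.

Lemma class_sizesE J : class_sizes J = mkseq (cnt J) #|~: J|.+1.
Proof.
rewrite /class_sizes; set r := filter _ _.
have -> : [seq #|class J a| | a <- r] = [seq cnt J l | l <- [seq bn J (a : 'I_n.+1) | a <- r]].
  by rewrite -map_comp; apply: eq_map => a; rewrite /= card_class.
rewrite /mkseq; congr map.
have mr a : (a \in r) = [forall b in class J a, (a <= b)%N].
  by rewrite mem_filter mem_enum andbT.
have tr : transitive (fun a b : 'I_n.+1 => (a < b)%N) by move=> a b c; apply: ltn_trans.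
apply: (irr_sorted_eq ltn_trans ltnn) => [||l].
- apply: (homo_sorted_in (e := fun a b : 'I_n.+1 => (a < b)%N) (P := mem r)).
  + move=> a b /= _; rewrite mr => /forall_inP H ab.
    rewrite ltn_neqAle bn_mono ?(ltnW ab) // andbT; apply/eqP => e.
    have := H a; rewrite inE connect_bn e eqxx => /(_ isT); lia.
  + exact/allP.
  + apply: sorted_filter => //.
    have := @sorted_map _ _ (val : 'I_n.+1 -> nat) ltn (enum 'I_n.+1).
    by rewrite val_enum_ord iota_ltn_sorted => <-.
- exact: iota_ltn_sorted.
rewrite mem_iota /= add0n ltnS; apply/mapP/idP => [[a _ ->]|/bn_hit[a e H]].
  exact: bn_max.
exists a => //; rewrite mr; apply/forall_inP => b; rewrite inE connect_bn => /eqP e'.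
by apply: H; rewrite -e'.
Qed.

Lemma size_class_sizes J : size (class_sizes J) = #|~: J|.+1.
Proof. by rewrite class_sizesE size_mkseq. Qed.

(** The sizes give the partial sums, these locate the block number of each integer, and [J] consists
    of the places where this number does not grow. *)
Lemma class_sizes_inj : injective (@class_sizes n).
Proof.
move=> I J e; have ek : #|~: I| = #|~: J|.
  by have := size_class_sizes I; rewrite e size_class_sizes => -[].
have ec l : (l <= #|~: J|)%N -> cnt I l = cnt J l.
  move=> lk; have := congr1 (fun r => nth 0%N r l) e.
  by rewrite !class_sizesE ek !nth_mkseq.
have ep l : (l <= #|~: J|.+1)%N -> psum I l = psum J l.
  elim: l => [|l IH] lk; first by rewrite /psum !big1.
  by rewrite !psumS IH ?ec // ltnW.
have eb m : (m <= n)%N -> bn I m = bn J m.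
  move=> mn; apply: psum_unique => //.
  have h := @bn_max J (Ordinal (mn : (m < n.+1)%N)).
  by rewrite !ep ?ltnS // ?psum_le ?psum_gt // ltnW.
apply/setP => d; have h (K : {set 'I_n}) : (d \in K) = (bn K d.+1 == bn K d).
  by rewrite bnS inJ_ord; case: (d \in K) => /=; rewrite ?addn0 ?eqxx //; lia.
by rewrite !h !eb // ltnW.
Qed.

HB.instance Definition _ := [isSub for (@parts n)].

Lemma lncob_proof J : all (ltn 0) (class_sizes J) && (sumn (class_sizes J) == n.+1)%N.
Proof.
rewrite class_sizesE -psumE psum_total eqxx andbT; apply/allP => m /mapP[l].
by rewrite mem_iota add0n ltnS => lk ->; apply: cnt_gt0.
Qed.

Definition lncob_of J : lncob n := LncOb (lncob_proof J).

(** * The subset attached to a composition of n + 1 *)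

Section Inverse.
Variable c : lncob n.
Let k := (size c).-1.
Let P l := sumn (take l c).

(** The generator s_j joins j and j + 1, so it is left out exactly when j + 1 starts a new class;
    the starting points other than 0 are the proper partial sums. *)
Definition set_of : {set 'I_n} :=
  [set j : 'I_n | j.+1 \notin [seq sumn (take l c) | l <- iota 1 (size c).-1]].

Lemma lncob_pos l : (l < size c)%N -> (0 < nth 0%N c l)%N.
Proof. by move=> h; have /andP[/allP H _] := partsP c; apply: H; apply: mem_nth. Qed.

Lemma lncob_size : size c = k.+1.
Proof.
by rewrite /k; case: (c) => -[|a r] //= /andP[_ /eqP]. 
Qed.

Lemma PS l : (l <= k)%N -> P l.+1 = (P l + nth 0%N c l)%N.
Proof.
move=> lk; rewrite /P (take_nth 0%N) ?sumn_rcons //.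
by rewrite lncob_size ltnS.
Qed.

Lemma P_total : P k.+1 = n.+1.
Proof.
have /andP[_ /eqP <-] := partsP c; by rewrite /P -lncob_size take_size.
Qed.

Lemma P_lt l m : (l < m)%N -> (m <= k.+1)%N -> (P l < P m)%N.
Proof.
elim: m => // m IH; rewrite ltnS leq_eqVlt => /orP[/eqP->|lm] mk.
  by rewrite PS // -addn1 leq_add2l lncob_pos // lncob_size.
apply: ltn_trans (IH lm (ltnW mk)) _.
by rewrite PS // -addn1 leq_add2l lncob_pos // lncob_size.
Qed.

Lemma P_le l m : (l <= m)%N -> (m <= k.+1)%N -> (P l <= P m)%N.
Proof. by rewrite leq_eqVlt => /orP[/eqP->//|lm mk]; apply/ltnW/P_lt. Qed.

Lemma bn_set_of m : (m <= n)%N ->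
  [/\ (bn set_of m <= k)%N, (P (bn set_of m) <= m)%N & (m < P (bn set_of m).+1)%N].
Proof.
elim: m => [|m IH] mn.
  have b0 : bn set_of 0 = 0%N by rewrite /bn big_ord0.
  rewrite b0; split=> //; first by rewrite /P take0.
  by have := @P_lt 0 1 isT isT; rewrite /P take0.
have [jk h1 h2] := IH (ltnW mn); rewrite bnS; set j := bn _ m in jk h1 h2 *.
have -> : inJ set_of m = (m.+1 \notin [seq P l | l <- iota 1 k]).
  by rewrite -[m]/(val (Ordinal mn)) inJ_ord inE.
rewrite negbK; have [e|ne] := eqVneq m.+1 (P j.+1).
  have jk' : (j < k)%N.
    rewrite ltn_neqAle jk andbT; apply: contraTneq mn => jE.
    by rewrite e jE P_total ltnn.
  have -> : m.+1 \in [seq P l | l <- iota 1 k].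
    by rewrite e; apply: map_f; rewrite mem_iota; lia.
  by rewrite addn1; split=> //; [rewrite e|rewrite e P_lt].
have -> : (m.+1 \in [seq P l | l <- iota 1 k]) = false.
  apply/negP => /mapP[l]; rewrite mem_iota => lk e.
  case: (ltngtP l j.+1) => [lj|jl|el].
  - have := @P_le l j; rewrite -ltnS => /(_ lj); lia.
  - have := @P_le j.+1 l (ltnW jl); clear IH; lia.
  - by rewrite e el eqxx in ne.
rewrite addn0; split=> //; first exact: leqW.
by rewrite ltn_neqAle ne.
Qed.

Lemma bn_set_of_uniq m l : (m <= n)%N -> (l <= k)%N ->
  (bn set_of m == l) = (P l <= m)%N && (m < P l.+1)%N.
Proof.
move=> mn lk; have [jk h1 h2] := bn_set_of mn; apply/eqP/idP => [<-|/andP[h3 h4]].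
  by rewrite h1 h2.
case: (ltngtP (bn set_of m) l) => // lt.
  by have := P_le lt (leqW lk); lia.
by have := P_le lt (leqW jk); lia.
Qed.

Lemma card_set_of : #|~: set_of| = k.
Proof.
rewrite -bn_total; apply/eqP; rewrite bn_set_of_uniq // P_total ltnSn andbT.
by rewrite -ltnS -P_total P_lt.
Qed.

Lemma class_sizes_set_of : class_sizes set_of = c.
Proof.
rewrite class_sizesE card_set_of; apply: (@eq_from_nth _ 0%N) => [|l].
  by rewrite size_mkseq lncob_size.
rewrite size_mkseq => lk; rewrite nth_mkseq // /cnt.
rewrite (eq_bigr (fun a : 'I_n.+1 => ((P l <= a) && (a < P l.+1))%N : nat)) => [|a _].
  rewrite interval_card ?P_le // PS //.
  by have := @P_le l.+1 k.+1 lk (leqnn _); rewrite P_total PS //; lia.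
by rewrite bn_set_of_uniq // -ltnS ltn_ord.
Qed.

End Inverse.

Lemma set_ofK : cancel set_of lncob_of.
Proof. by move=> c; apply: val_inj; rewrite /= class_sizes_set_of. Qed.

Lemma lncob_ofK : cancel lncob_of set_of.
Proof. by move=> J; apply: class_sizes_inj; rewrite class_sizes_set_of. Qed.

End Objects.

Lemma size_swap_parts i c : (i.+1 < size c)%N -> size (swap_parts i c) = size c.
Proof.
rewrite /swap_parts; case: eqP => // _ h.
by rewrite !size_cat size_takel ?size_drop /=; lia.
Qed.

Lemma nth_swap_parts i c (j : nat) : (i.+1 < size c)%N ->
  nth 0%N (swap_parts i c) j = nth 0%N c (absz (sg i j%:Z)).
Proof.
move=> h; rewrite /swap_parts; case: eqP => [->|/eqP i0].
  by congr nth; sgl.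
rewrite !nth_cat size_takel; last by lia.
case: ltnP => ji; first by rewrite nth_take //; congr nth; sgl.
have [->|ne] := eqVneq j i; first by rewrite subnn /=; congr nth; sgl.
have [->|ne'] := eqVneq j i.+1; first by rewrite subSnn /=; congr nth; sgl.
have -> /= : (j - i < 2)%N = false by lia.
by rewrite nth_drop; congr nth; sgl.
Qed.

(** * Class sizes of the target of an atomic coset *)

Section Target.
Context {n : nat} {X : sysB n}.
Implicit Types (I J : {set 'I_n}).

Lemma wact_bound (w : X) x : (absz x <= n)%N -> (absz (wact w x) <= n)%N.
Proof.
have [t <-] := wprod_onto w; move=> h; elim: t => [|i t IH].
  by rewrite wprod_nil wact1.
by rewrite wprod_cons wactM wact_s sg_bound.
Qed.

Lemma infl_bn I J i (w : X) : infl I J (sg i) w ->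
  forall a : nat, bn I (absz (wact w a)) = absz (sg i (bn J a)).
Proof.
move=> [h _] a; have := h a%:Z; rewrite bl_nat => <-.
case: (wact w a) => m //=.
by rewrite abszN.
Qed.

Lemma inflV I J i (w : X) : infl I J (sg i) w -> infl J I (sg i) w^-1%g.
Proof.
move=> h; have c := infl_core (can_inj (sgK i)) h; split; last exact: (coreV c).2.
by move=> x; apply: (can_inj (sgK i)); rewrite sgK -h.1 wactKV.
Qed.

(* [a |-> |w a|] is injective on [0, n] and permutes the absolute values of the
   block numbers. *)
Lemma cnt_le I J i (w : X) (l : nat) : infl I J (sg i) w ->
  (cnt J l <= cnt I (absz (sg i l)))%N.
Proof.
move=> h.
have card (K : {set 'I_n}) m : cnt K m = #|[set a : 'I_n.+1 | bn K a == m]|.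
  by rewrite /cnt -sum1_card [RHS]big_mkcond; apply: eq_bigr => a _; rewrite inE; case: eqP.
have bd (a : 'I_n.+1) : (absz (wact w a) < n.+1)%N.
  by rewrite ltnS; apply: wact_bound; have := ltn_ord a; lia.
pose f (a : 'I_n.+1) : 'I_n.+1 := Ordinal (bd a).
have fI : injective f.
  move=> a b /(congr1 val) /= e; apply: val_inj => /=.
  have : (wact w a == wact w b) || (wact w a == - wact w b) by lia.
  by rewrite wact_eqN (inj_eq (@wact_inj n X w)); lia.
rewrite !card -(card_imset _ fI); apply: subset_leq_card.
apply/subsetP => b /imsetP[a]; rewrite !inE => /eqP e ->.
by rewrite /f /= (infl_bn h) e.
Qed.

Lemma infl_cnt I J i (w : X) (l : nat) : infl I J (sg i) w ->
  cnt I (absz (sg i l)) = cnt J l.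
Proof.
move=> h; apply/eqP; rewrite eqn_leq (cnt_le _ h) andbT.
have := cnt_le (absz (sg i l)) (inflV h).
by have -> : absz (sg i (absz (sg i l))) = l by sgl.
Qed.

(** The element w^-1 keeps [n] within [-n, n], and [sg i] fixes every number above the top block
    number of [J]; so [n] cannot have such a number in [I]. *)
Lemma infl_card_le I J i (w : X) : (i < #|~: J|)%N -> infl I J (sg i) w ->
  (#|~: I| <= #|~: J|)%N.
Proof.
move=> ik h; have := @bn_max n J (inord (absz (wact w^-1%g n))).
rewrite inordK; last by rewrite ltnS wact_bound.
by rewrite (infl_bn (inflV h)) bn_total; sgl.
Qed.

Lemma class_sizes_atarget J (i : 'I_#|~: J|) :
  class_sizes (atarget (@gen n X) i) = swap_parts i (class_sizes J).
Proof.
have h := atomic_infl (X := X) i; have ik := ltn_ord i.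
have le1 := infl_card_le ik h.
have e : #|~: atarget (@gen n X) i| = #|~: J|.
  apply/eqP; rewrite eqn_leq le1 /=.
  (* Points in the top block k and in block i: if i + 1 = k and i > 0, then [sg i] lowers k to i,
     but it raises i to k, so one of the two images always shows that [I] has a block numbered k. *)
  have [a ea _] := bn_hit (leqnn #|~: J|).
  have [b eb _] := bn_hit (J := J) (ltnW ik).
  have ha := infl_bn h a; have hb := infl_bn h b; rewrite ea eb in ha hb.
  set v := (longest (@gen n X) (atop i) * longest (@gen n X) J)%g.
  have B (c : 'I_n.+1) : (bn (atarget (@gen n X) i) (absz (wact v c)) <=
      #|~: atarget (@gen n X) i|)%N.
    rewrite -bn_total bn_mono // wact_bound //; have := ltn_ord c; lia.
  have key (r k k' : nat) : (r < k)%N -> (absz (sg r k) <= k')%N ->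
    (absz (sg r r) <= k')%N -> (k <= k')%N by sgl.
  by apply: key ik _ _; [rewrite -ha B|rewrite -hb B].
apply: (@eq_from_nth _ 0%N).
  by rewrite size_swap_parts !size_class_sizes ?e // !ltnS.
rewrite size_class_sizes e => l lk; rewrite nth_swap_parts ?size_class_sizes ?ltnS //.
rewrite !class_sizesE !nth_mkseq ?e //; last first.
  have key (r k m : nat) : (r < k)%N -> (m < k.+1)%N ->
    (absz (sg r m) < k.+1)%N by sgl.
  exact: key ik lk.
rewrite -(infl_cnt _ h); congr cnt.
have key (r m : nat) : m = absz (sg r (absz (sg r m))) by sgl.
exact: key.
Qed.

End Target.

(** * The functor from the presented category *)

Section Arrows.

Lemma existT_inj T (P : T -> Type) (x : T) (a b : P x) :
  existT P x a = existT P x b -> a = b.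
Proof.
move=> e; have := projT2_eq e.
by rewrite (Prop_irrelevance (projT1_eq e) erefl).
Qed.

Variable C : lincat.

Lemma Arrow_inj (x y : C) (f g : hom x y) : Arrow f = Arrow g -> f = g.
Proof. exact: (fun e => existT_inj (existT_inj e)). Qed.

Lemma Arrow_src (x y x' y' : C) (f : hom x y) (g : hom x' y') :
  Arrow f = Arrow g -> x = x'.
Proof. exact: (fun e => congr1 (@projT1 _ _) e). Qed.

Lemma Arrow_tgt (x y x' y' : C) (f : hom x y) (g : hom x' y') :
  Arrow f = Arrow g -> y = y'.
Proof. exact: (fun e => congr1 (fun a : arrow C => projT1 (projT2 a)) e). Qed.

Lemma Arrow_add (x y x' y' : C) (f g : hom x y) (f' g' : hom x' y') :
  Arrow f = Arrow f' -> Arrow g = Arrow g' -> Arrow (f + g) = Arrow (f' + g').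
Proof.
move=> e; have ex := Arrow_src e; have ey := Arrow_tgt e.
by subst x' y'; move: e => /Arrow_inj-> /Arrow_inj->.
Qed.

Lemma Arrow_id (x x' : C) : x = x' -> Arrow (idm x) = Arrow (idm x').
Proof. by move->. Qed.

Lemma Arrow_comp (x y z x' y' z' : C) (f : hom y z) (g : hom x y)
    (f' : hom y' z') (g' : hom x' y') :
  Arrow f = Arrow f' -> Arrow g = Arrow g' -> Arrow (comp f g) = Arrow (comp f' g').
Proof.
move=> e1 e2; have ex := Arrow_src e2; have ey := Arrow_src e1.
have ez := Arrow_tgt e1.
by subst x' y' z'; move: e1 e2 => /Arrow_inj-> /Arrow_inj->.
Qed.

Lemma Arrow0 (x y x' y' : C) (f : hom x y) :
  Arrow f = Arrow (0 : hom x' y') -> f = 0.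
Proof.
move=> e; have ex := Arrow_src e; have ey := Arrow_tgt e.
by subst x' y'; move/Arrow_inj: e.
Qed.

Hypothesis HC : is_lincat C.

Lemma lincat_comp0r (x y z : C) (f : hom y z) : comp f (0 : hom x y) = 0.
Proof. by apply: (addrI (comp f 0)); rewrite -(lincat_compDr HC) !addr0. Qed.

Lemma lincat_comp0l (x y z : C) (f : hom x y) : comp (0 : hom y z) f = 0.
Proof. by apply: (addrI (comp 0 f)); rewrite -(lincat_compDl HC) !addr0. Qed.

Lemma lincat_compBr (x y z : C) (f : hom y z) (g h : hom x y) :
  comp f (g - h) = comp f g - comp f h.
Proof. by apply: (addIr (comp f h)); rewrite -(lincat_compDr HC) !subrK. Qed.

Lemma lincat_compNl (x y z : C) (f : hom y z) (g : hom x y) :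
  comp (- f) g = - comp f g.
Proof.
by apply: (addIr (comp f g)); rewrite -(lincat_compDl HC) !addNr lincat_comp0l.
Qed.

End Arrows.

(** Preimages of morphisms are chosen, and each law of the inverse functor follows by applying the
    faithful [F] to packed arrows. *)
Lemma linfunctor_iso (C D : lincat) (F : linfunctor C D) (fi : D -> C) :
    is_lincat C -> is_lincat D -> cancel F fi -> cancel fi F ->
    (forall x y : C, injective (@fmap C D F x y)) ->
    (forall (x y : C) (g : hom (F x) (F y)), exists f : hom x y, fmap F f = g) ->
  is_lincat_iso F.
Proof.
move=> HC HD FK fiK Finj Fsurj.
have ex (u v : D) (g : hom u v) :
    exists f : hom (fi u) (fi v), Arrow (fmap F f) = Arrow g.
  (* With general [x] and [y] the equations between objects can be eliminated by substitution. *)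
  have H x y : F x = u -> F y = v -> exists f : hom x y, Arrow (fmap F f) = Arrow g.
    by move=> eu ev; subst u v; have [f <-] := Fsurj _ _ g; exists f.
  exact: H.
pose G (u v : D) (g : hom u v) := sval (cid (ex u v g)).
have GE (u v : D) (g : hom u v) : Arrow (fmap F (G u v g)) = Arrow g.
  by rewrite /G; case: cid.
have AF (x y x' y' : C) (f : hom x y) (f' : hom x' y') :
    Arrow (fmap F f) = Arrow (fmap F f') -> Arrow f = Arrow f'.
  move=> e; have ex' := can_inj FK (Arrow_src e); have ey := can_inj FK (Arrow_tgt e).
  by subst x' y'; move/Arrow_inj/Finj: e => ->.
have GD u v (f g : hom u v) : G _ _ (f + g) = G _ _ f + G _ _ g.
  by apply/Arrow_inj/AF; rewrite GE fmapD; apply/esym/Arrow_add.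
have G1 u : G _ _ (idm u) = idm (fi u).
  by apply/Arrow_inj/AF; rewrite GE fmap1; apply: Arrow_id; rewrite fiK.
have GM u v w (f : hom v w) (g : hom u v) : G _ _ (comp f g) = comp (G _ _ f) (G _ _ g).
  by apply/Arrow_inj/AF; rewrite GE fmapM; apply/esym/Arrow_comp.
split=> //; exists (LinFunctor GD G1 GM); split=> //.
  by case=> x [y f]; apply: (AF _ _ _ _ _ f); rewrite /= GE.
by case=> u [v g]; rewrite /arrow_map /= GE.
Qed.

(** * Definition of the functor on terms and on classes *)

Section Functor.
Context {n : nat} (X : sysB n) (Y : forall k, sysB k).
Local Notation s := (@gen n X).
Local Notation A := (ADcat s).
Local Notation L := (LNCB n).
Local Notation bas := (@bas n X).
Implicit Types (c d e : lncob n).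

Lemma card_eq c : (size c).-1 = #|~: set_of c|.
Proof. by rewrite card_set_of. Qed.

Definition aidx c d (g : lncgen c d) := cast_ord (card_eq c) (gidx g).

Lemma set_of_target c d (g : lncgen c d) : set_of d = atarget s (aidx g).
Proof.
apply: class_sizes_inj; rewrite class_sizes_atarget !class_sizes_set_of.
exact/eqP/(gidxP g).
Qed.

Definition avec c d (g : lncgen c d) : X :=
  (longest s (atop (aidx g)) * longest s (set_of c))%g.

Lemma avec_infl c d (g : lncgen c d) :
  infl (set_of d) (set_of c) (sg (gidx g)) (avec g).
Proof. by rewrite (set_of_target g); apply: (atomic_infl (aidx g)). Qed.

Lemma avec_arrow c d (g : lncgen c d) :
  @Arrow (Dcat s) _ _ (bas (set_of d) (set_of c) (avec g)) =
  @Arrow (Dcat s) _ _ (atomic s (aidx g)).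
Proof. by rewrite (set_of_target g) atomic_bas. Qed.

Lemma avec_generated c d (g : lncgen c d) :
  generated (@is_atomic X n s) (bas (set_of d) (set_of c) (avec g)).
Proof. by rewrite (set_of_target g) -atomic_bas; apply: gen_in; constructor. Qed.

Definition gmap c d (g : lncgen c d) : @hom A (set_of c) (set_of d) :=
  SubHom (asboolT (avec_generated g)).

Fixpoint interp c d (t : term (@lncgen n) c d) : @hom A (set_of c) (set_of d) :=
  match t with
  | TGen _ _ g => gmap g
  | TId _ => idm _
  | TComp _ _ _ t u => comp (interp t) (interp u)
  | TZero _ _ => 0
  | TAdd _ _ t u => interp t + interp u
  | TOpp _ _ t => - interp t
  end.

Lemma len_gen k (i : 'I_k) : len (@gen k (Y k)) (gen (Y k) i) = 1%N.
Proof.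
rewrite -(mulg1 (gen (Y k) i)) len_lmul invg1 len1.
have -> // : desc (1%g : Y k) i = false by rewrite /desc !wact1; lia.
Qed.

Lemma size_target c d (g : lncgen c d) : size d = size c.
Proof.
have /eqP -> := gidxP g; rewrite size_swap_parts //.
by have := ltn_ord (gidx g); lia.
Qed.

(** The indices form a word in W_k, and [x] is the inflation of its value. The composite is the
    basis element of [x] if that word is reduced and 0 otherwise. *)
Lemma word_interp k (r : seq nat) c d (t : term (@lncgen n) c d) :
    is_word r t -> (size c).-1 = k ->
  exists (q : seq 'I_k) (x : X),
    [/\ map val q = r, size d = size c,
        infl (set_of d) (set_of c) (wact (wprod (@gen k (Y k)) q)) x &
        subval (interp t) = if size q == len (@gen k (Y k)) (wprod (@gen k (Y k)) q)
          then bas (set_of d) (set_of c) x else 0].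
Proof.
elim=> {r c d t} [c d g|c d e g r t _ IH] ek.
  exists [:: cast_ord ek (gidx g)], (avec g).
  rewrite wprod_cons wprod_nil mulg1 len_gen /=; split=> //.
    exact: size_target g.
  have := avec_infl g; congr (infl _ _ _ _); apply/funext => x.
  by rewrite wact_s.
have [q [x [eq ed ix ei]]] := IH ek.
have ek' : (size d).-1 = k by rewrite ed.
pose i := cast_ord ek' (gidx g).
exists (i :: q), (avec g * x)%g.
have ig : infl (set_of e) (set_of d) (wact (gen (Y k) i)) (avec g).
  have := avec_infl g; congr (infl _ _ _ _); apply/funext => y.
  by rewrite wact_s.
rewrite wprod_cons; split.
- by rewrite /= eq.
- by rewrite (size_target g).
- have := infl_mul ig ix; congr (infl _ _ _ _); apply/funext => y.
  by rewrite wactM.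
rewrite /= ei; set w := wprod _ q; have h1 := @len_min k (Y k) q.
rewrite -/w in h1; have h2 := len_mul (gen (Y k) i) w; rewrite len_gen in h2.
(* A word with a non-reduced tail is not reduced. *)
case: eqP => e1; last first.
  rewrite (_ : (_ == _) = false); first exact: dcomp0r.
  by apply/negbTE/eqP; lia.
have cg := infl_core (@wact_inj k (Y k) (gen (Y k) i)) ig.
have cx := infl_core (@wact_inj k (Y k) w) ix.
have := core_comp cg cx; rewrite (infl_len ig ix) len_gen -e1 add1n eq_sym => <-.
by [].
Qed.

(** Two words of equal size and equal value in W_k are reduced together and have the same inflation,
    so each relation reduces to an identity in W_k. *)
Lemma rel_interp (r1 r2 : seq nat) c d (t u : term (@lncgen n) c d) :
    is_word r1 t -> is_word r2 u -> size r1 = size r2 ->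
    (forall k (q1 q2 : seq 'I_k), map val q1 = r1 -> map val q2 = r2 ->
      wprod (@gen k (Y k)) q1 = wprod (@gen k (Y k)) q2) ->
  interp t = interp u.
Proof.
move=> h1 h2 es H; apply: val_inj => /=.
have [q1 [x1 [e1 _ i1 ->]]] := word_interp h1 erefl.
have [q2 [x2 [e2 _ i2 ->]]] := word_interp h2 erefl.
have es' : size q1 = size q2 by rewrite -(size_map val) e1 es -e2 size_map.
rewrite (H _ _ _ e1 e2) in i1 *; rewrite es'.
by have [-> _] := infl_uniq (@wact_inj _ _ _) i1 i2.
Qed.

Lemma interp_rel c d (t u : term (@lncgen n) c d) : lncrel t u -> interp t = interp u.
Proof.
case=> {c d t u}.
- move=> c d t u h1 h2; apply: (rel_interp h1 h2) => // k.
  move=> [|a [|b [|a' [|b' [|? ?]]]]] // [|p [|q [|p' [|q' [|? ?]]]]] //.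
  move=> [ea eb ea' eb'] [ep eq ep' eq'].
  have -> : a' = a by apply: val_inj; rewrite /= ea ea'.
  have -> : b' = b by apply: val_inj; rewrite /= eb eb'.
  have -> : p = b by apply: val_inj; rewrite /= ep eb.
  have -> : p' = b by apply: val_inj; rewrite /= ep' eb.
  have -> : q = a by apply: val_inj; rewrite /= eq ea.
  have -> : q' = a by apply: val_inj; rewrite /= eq' ea.
  by rewrite !wprod_cons wprod_nil !mulg1 braid4.
- move=> c d t u i i0 h1 h2; apply: (rel_interp h1 h2) => // k.
  move=> [|a [|b [|a' [|? ?]]]] // [|p [|q [|p' [|? ?]]]] //.
  move=> [ea eb ea'] [ep eq ep'].
  have -> : a' = a by apply: val_inj; rewrite /= ea ea'.
  have -> : p = b by apply: val_inj; rewrite /= ep eb.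
  have -> : p' = b by apply: val_inj; rewrite /= ep' eb.
  have -> : q = a by apply: val_inj; rewrite /= eq ea.
  by rewrite !wprod_cons wprod_nil !mulg1 braid3 ?ea ?eb.
- move=> c d t u i j ij h1 h2; apply: (rel_interp h1 h2) => // k.
  move=> [|a [|b [|? ?]]] // [|p [|q [|? ?]]] //.
  move=> [ea eb] [ep eq].
  have -> : p = b by apply: val_inj; rewrite /= ep eb.
  have -> : q = a by apply: val_inj; rewrite /= eq ea.
  by rewrite !wprod_cons wprod_nil !mulg1 braid2 // ea eb.
move=> c d t i h; apply: val_inj => /=.
have [q [x [e _ _ ->]]] := word_interp h erefl.
case: q e => [|a [|b [|? ?]]] // [ea eb].
have -> : b = a by apply: val_inj; rewrite /= ea eb.
by rewrite !wprod_cons wprod_nil mulg1 s_sq len1.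
Qed.

Lemma interp_cong c d (t u : term (@lncgen n) c d) :
  cong (@lncrel n) t u -> interp t = interp u.
Proof.
have HA := ADcat_is_lincat (X := X).
elim=> {c d t u} /=.
- by move=> c d t u; apply: interp_rel.
- by [].
- by move=> c d t u _ ->.
- by move=> c d t u v _ -> _ ->.
- by move=> c d e t t' u u' _ -> _ ->.
- by move=> c d t t' u u' _ -> _ ->.
- by move=> c d t t' _ ->.
- by move=> c d t u v; rewrite addrA.
- by move=> c d t u; rewrite addrC.
- by move=> c d t; rewrite add0r.
- by move=> c d t; rewrite addNr.
- by move=> b c d e t u v; apply: (lincat_compA HA).
- by move=> c d t; apply: (lincat_comp1m HA).
- by move=> c d t; apply: (lincat_compm1 HA).
- by move=> c d e t u v; apply: (lincat_compDl HA).
- by move=> c d e t u v; apply: (lincat_compDr HA).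
Qed.

Definition psi_map (c d : L) (f : hom c d) : @hom A (set_of c) (set_of d) :=
  interp (rep f).

Lemma psi_cls c d (t : term (@lncgen n) c d) :
  psi_map (cls (@lncrel n) t : @hom L c d) = interp t.
Proof. exact/interp_cong/cong_rep. Qed.

Lemma psi_add (c d : L) (f g : hom c d) : psi_map (f + g) = psi_map f + psi_map g.
Proof. exact: psi_cls. Qed.

Lemma psi_id (c : L) : psi_map (idm c) = idm (set_of c : A).
Proof. exact: psi_cls. Qed.

Lemma psi_comp (c d e : L) (f : hom d e) (g : hom c d) :
  psi_map (comp f g) = comp (psi_map f) (psi_map g).
Proof. exact: psi_cls. Qed.

Definition psi : linfunctor L A := LinFunctor psi_add psi_id psi_comp.

Lemma psi_gen c d (g : lncgen c d) :
  subval (fmap psi (lncmor g)) = bas (set_of d) (set_of c) (avec g).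
Proof. by rewrite /lncmor /pgen /= psi_cls. Qed.

End Functor.

(** * Words in the presented category *)

(** The absolute value of [sg i m]: the effect of s_i on the positions of the parts. It serves to
    show that the two sides of a relation have the same target. *)
Definition swap_idx (i m : nat) : nat :=
  if i == 0%N then m else if m == i then i.+1 else if m == i.+1 then i else m.

Lemma swap_idx_comm i j m : commuting i j ->
  swap_idx i (swap_idx j m) = swap_idx j (swap_idx i m).
Proof.
rewrite /commuting /swap_idx => ij.
case: (eqVneq i 0%N) => //= i0; case: (eqVneq j 0%N) => //= j0.
by case: (eqVneq m i) => [->|n1]; [|case: (eqVneq m i.+1) => [e|n2]]; ifs; lia.
Qed.

Lemma swap_idx_braid i m : (0 < i)%N ->
  swap_idx i (swap_idx i.+1 (swap_idx i m)) =
  swap_idx i.+1 (swap_idx i (swap_idx i.+1 m)).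
Proof.
move=> i0; rewrite /swap_idx (gtn_eqF i0) /=.
by case: (eqVneq m i) => [->|n1]; [|case: (eqVneq m i.+1) => [e|n2]]; ifs; lia.
Qed.

Lemma nth_swap i c m : (i.+1 < size c)%N ->
  nth 0%N (swap_parts i c) m = nth 0%N c (swap_idx i m).
Proof. by move=> h; rewrite nth_swap_parts //; congr nth; rewrite /swap_idx; sgl. Qed.

Section Words.
Context {n : nat}.
Local Notation L := (LNCB n).
Implicit Types (c d e : lncob n).

Let HL : is_lincat L := presented_is_lincat (@lncrel n).

Definition swapob (i : nat) c : lncob n := insubd c (swap_parts i c).

(** The swapped list is again a composition of n + 1 because it lists the class sizes of the target
    of an atomic coset; the default value [c] of [insubd] does not occur. *)
Lemma swapobE i c : (i < (size c).-1)%N -> parts (swapob i c) = swap_parts i c.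
Proof.
move=> ic; have ic' : (i < #|~: set_of c|)%N by rewrite card_set_of.
have := class_sizes_atarget (X := WBsys n) (Ordinal ic').
rewrite class_sizes_set_of /= => e.
rewrite /swapob insubdK // -e; exact: lncob_proof.
Qed.

Lemma gm_proof i c (h : (i < (size c).-1)%N) :
  parts (swapob i c) == swap_parts (Ordinal h) c.
Proof. by rewrite swapobE. Qed.

(* The generator with index [i] and source [c], or 0 if there is none. *)
Definition gm (i : nat) c : @hom L c (swapob i c) :=
  if @idP (i < (size c).-1)%N is ReflectT h then lncmor (LncGen (gm_proof h)) else 0.

Lemma lncgen_inj c d : injective (@gidx n c d).
Proof.
move=> [o p] [o' p'] /= e; subst o'; congr LncGen; exact: bool_irrelevance.
Qed.

Lemma gmE c d (g : lncgen c d) : Arrow (gm (gidx g) c) = @Arrow L _ _ (lncmor g).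
Proof.
case: g => o p /=; have e : d = swapob o c.
  by apply: val_inj; rewrite /= swapobE ?ltn_ord //; apply/eqP.
subst d; congr Arrow; rewrite /gm; case: {-}_ / idP => [h|[]]; last exact: ltn_ord.
by congr lncmor; apply: lncgen_inj; apply: val_inj.
Qed.

(** Composition with the generator of index [i] at whatever target the arrow has: a self-map of a
    single type, as [matsumoto] requires. *)
Definition gact (i : nat) (a : arrow L) : arrow L :=
  let: existT c (existT d f) := a in Arrow (comp (gm i d) f).

Lemma gact_gen b c d (g : lncgen c d) (f : @hom L b c) :
  gact (gidx g) (Arrow f) = Arrow (comp (lncmor g) f).
Proof. by apply: Arrow_comp => //; apply: gmE. Qed.

Lemma gact_word (r : seq nat) b c d (t : term (@lncgen n) c d) (f : @hom L b c) :
  is_word r t -> foldr gact (Arrow f) r = Arrow (comp (cls (@lncrel n) t : @hom L c d) f).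
Proof.
move=> h; elim: h b f => {r c d t} [c d g|c d e g r t _ IH] b f /=.
  exact: (gact_gen g).
rewrite IH gact_gen (lincat_compA HL); congr (Arrow (comp _ _)).
exact: cls_comp.
Qed.

Lemma word_ex (r : seq nat) c k : r != [::] -> (size c).-1 = k ->
    all (fun i => i < k)%N r ->
  exists e, parts e = foldr swap_parts c r /\
    exists t : term (@lncgen n) c e, is_word r t.
Proof.
elim: r => // i r IH _ ek /= /andP[ik rk].
have [er|nr] := eqVneq r [::].
  have h : (i < (size c).-1)%N by rewrite ek.
  rewrite er; exists (swapob i c); split; first by rewrite swapobE.
  by exists (TGen (LncGen (gm_proof h))); apply: (is_word1 (LncGen (gm_proof h))).
have [e [pe [t wt]]] := IH nr ek rk.
have ske (r' : seq nat) : all (fun i => i < k)%N r' -> size (foldr swap_parts c r') = size c.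
  elim: r' => //= j r' IH' /andP[jk /IH' es].
  by rewrite size_swap_parts es //; move: ek jk; clear; lia.
have h : (i < (size e).-1)%N by rewrite pe ske // ek.
exists (swapob i e); split; first by rewrite swapobE // pe.
exists (TComp (TGen (LncGen (gm_proof h))) t).
exact: (is_wordS (LncGen (gm_proof h))).
Qed.

Lemma gact_rel (r1 r2 : seq nat) b c k (f : @hom L b c) :
    (size c).-1 = k -> r1 != [::] -> r2 != [::] ->
    all (fun i => i < k)%N r1 -> all (fun i => i < k)%N r2 ->
    foldr swap_parts c r1 = foldr swap_parts c r2 ->
    (forall e (t u : term (@lncgen n) c e), is_word r1 t -> is_word r2 u -> lncrel t u) ->
  foldr gact (Arrow f) r1 = foldr gact (Arrow f) r2.
Proof.
move=> ek n1 n2 a1 a2 es H.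
have [e [p1 [t w1]]] := word_ex n1 ek a1; have [e' [p2 [u w2]]] := word_ex n2 ek a2.
have ee : e = e' by apply: val_inj; rewrite /= p1 p2.
subst e'; rewrite (gact_word f w1) (gact_word f w2).
by congr (Arrow (comp _ _)); apply/clsP/cong_rel/H.
Qed.

Lemma gact_nil i b c (f : @hom L b c) : (i < (size c).-1)%N ->
  exists e, gact i (gact i (Arrow f)) = Arrow (0 : @hom L b e).
Proof.
move=> ic; have [|e [_ [t wt]]] := @word_ex [:: i; i] c _ isT erefl.
  by rewrite /= ic.
exists e; rewrite -[gact i _]/(foldr gact (Arrow f) [:: i; i]) (gact_word f wt).
congr Arrow; rewrite (_ : cls _ t = 0 :> @hom L c e) ?(lincat_comp0l HL) //.
by apply/clsP/cong_rel/(lnc_nil wt).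
Qed.

(** The invariant for [matsumoto]: the target has k + 1 parts, so all generators with index below k
    exist there. *)
Definition with_size k (a : arrow L) : Prop :=
  exists b c (f : @hom L b c), a = Arrow f /\ (size c).-1 = k.

Lemma gact_size k (i : nat) a : (i < k)%N -> with_size k a -> with_size k (gact i a).
Proof.
move=> ik [b [c [f [-> ek]]]]; exists b, (swapob i c), (comp (gm i c) f); split=> //.
by rewrite swapobE ?ek // size_swap_parts ?ek //; move: ek ik; clear; lia.
Qed.

Lemma foldr_swap_eq k c (r1 r2 : seq nat) : size c = k.+1 ->
    all (fun i => i < k)%N r1 -> all (fun i => i < k)%N r2 ->
    (forall m, foldl (fun m i => swap_idx i m) m r1 = foldl (fun m i => swap_idx i m) m r2) ->
  foldr swap_parts c r1 = foldr swap_parts c r2.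
Proof.
move=> ec a1 a2 H.
have S (r : seq nat) : all (fun i => i < k)%N r -> size (foldr swap_parts c r) = k.+1.
  elim: r => //= j r IH /andP[jk /IH es].
  by rewrite size_swap_parts es // ltnS.
have N (r : seq nat) m : all (fun i => i < k)%N r ->
    nth 0%N (foldr swap_parts c r) m = nth 0%N c (foldl (fun m i => swap_idx i m) m r).
  elim: r m => //= j r IH m /andP[jk rk].
  by rewrite nth_swap ?S ?ltnS // IH.
apply: (@eq_from_nth _ 0%N) => [|m _]; first by rewrite !S.
by rewrite !N // H.
Qed.

Lemma gact_matsumoto k (Y : sysB k) (q q' : seq 'I_k) a : with_size k a ->
    size q = len (@gen k Y) (wprod (@gen k Y) q) -> size q' = size q ->
    wprod (@gen k Y) q = wprod (@gen k Y) q' ->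
  foldr gact a (map val q) = foldr gact a (map val q').
Proof.
move=> wa e1 e2 e3; rewrite !foldr_map.
have sz c : (size c).-1 = k -> size c = k.+1.
  by move=> ek; rewrite lncob_size ek.
apply: (@matsumoto k Y (arrow L) (fun i => gact i) (with_size k)) => //.
- by move=> i b; apply: gact_size.
- move=> i j _ [b [c [f [-> ek]]]] ij.
  have li := ltn_ord i; have lj := ltn_ord j.
  have a1 : all (fun l => l < k)%N [:: val i; val j] by rewrite /= li lj.
  have a2 : all (fun l => l < k)%N [:: val j; val i] by rewrite /= li lj.
  have es : foldr swap_parts c [:: val i; val j] = foldr swap_parts c [:: val j; val i].
    by apply: (foldr_swap_eq (sz c ek) a1 a2) => m; apply/esym/swap_idx_comm.
  apply: (gact_rel f ek _ _ a1 a2 es) => // e t u.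
  by move=> h1 h2; apply: lnc_comm h1 h2.
- move=> i j _ [b [c [f [-> ek]]]] i0 ij.
  have li := ltn_ord i; have lj := ltn_ord j.
  have a1 : all (fun l => l < k)%N [:: val i; val j; val i] by rewrite /= li lj.
  have a2 : all (fun l => l < k)%N [:: val j; val i; val j] by rewrite /= li lj.
  have es : foldr swap_parts c [:: val i; val j; val i] =
      foldr swap_parts c [:: val j; val i; val j].
    by apply: (foldr_swap_eq (sz c ek) a1 a2) => m; rewrite /= ij swap_idx_braid.
  apply: (gact_rel f ek _ _ a1 a2 es) => // e t u.
  by rewrite /= ij => h1 h2; apply: lnc_braid3 h1 h2.
- move=> i j _ [b [c [f [-> ek]]]] i0 j1.
  have li := ltn_ord i; have lj := ltn_ord j.
  have a1 : all (fun l => l < k)%N [:: val i; val j; val i; val j] by rewrite /= li lj.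
  have a2 : all (fun l => l < k)%N [:: val j; val i; val j; val i] by rewrite /= li lj.
  have es : foldr swap_parts c [:: val i; val j; val i; val j] =
      foldr swap_parts c [:: val j; val i; val j; val i].
    by apply: (foldr_swap_eq (sz c ek) a1 a2) => m; rewrite /= i0 j1.
  apply: (gact_rel f ek _ _ a1 a2 es) => // e t u.
  by rewrite /= i0 j1 => h1 h2; apply: lnc_braid4 h1 h2.
Qed.

(** * Spanning the morphisms with a fixed source *)

Section Span.
Variables (Y : forall k, sysB k) (c : lncob n).
Let k := (size c).-1.
Local Notation Yk := (Y k).
Local Notation sY := (@gen k Yk).
Local Notation len := (len sY).
Local Notation wprod := (wprod sY).

Definition wmor (w : Yk) : arrow L :=
  foldr gact (Arrow (idm (c : L))) (map val (redword sY w)).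

Lemma id_size : with_size k (Arrow (idm (c : L))).
Proof. by exists c, c, (idm (c : L)). Qed.

Lemma wmor_word (q : seq 'I_k) : size q = len (wprod q) ->
  foldr gact (Arrow (idm (c : L))) (map val q) = wmor (wprod q).
Proof.
move=> e; have [e1 e2] := redwordP (wprod q).
by apply: (gact_matsumoto id_size e) => //; rewrite e1.
Qed.

Lemma wmor_size (w : Yk) : with_size k (wmor w).
Proof.
rewrite /wmor; elim: (redword sY w) => [|i q IH] /=; first exact: id_size.
by apply: gact_size IH; apply: ltn_ord.
Qed.

Lemma gact_wmor (i : 'I_k) (w : Yk) : ~~ desc w^-1%g i ->
  gact i (wmor w) = wmor (sY i * w)%g.
Proof.
move=> nd; have [e1 e2] := redwordP w.
have := @wmor_word (i :: redword sY w); rewrite wprod_cons e2 /= => <- //.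
by rewrite len_lmul (negbTE nd) e1.
Qed.

Inductive lspanned d : @hom L c d -> Prop :=
| lspan0 : lspanned 0
| lspanB f g : lspanned f -> lspanned g -> lspanned (f - g)
| lspanE (w : Yk) f : Arrow f = wmor w -> lspanned f.

Lemma lspanN d (f : @hom L c d) : lspanned f -> lspanned (- f).
Proof. by move=> sf; rewrite -[- f]add0r; apply: lspanB => //; apply: lspan0. Qed.

Lemma lspanD d (f g : @hom L c d) : lspanned f -> lspanned g -> lspanned (f + g).
Proof. by move=> sf sg; rewrite -[g]opprK; apply: lspanB => //; apply: lspanN. Qed.

Lemma lspan_gen d e (g : lncgen d e) (f : @hom L c d) :
  lspanned f -> lspanned (comp (lncmor g) f).
Proof.
elim=> [|f1 f2 _ IH1 _ IH2|w {}f ef].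
- by rewrite (lincat_comp0r HL); apply: lspan0.
- by rewrite (lincat_compBr HL); apply: lspanB.
have ed : (size d).-1 = k.
  have [b [d' [f' [e1 e2]]]] := wmor_size w; rewrite -e2.
  by rewrite (Arrow_tgt (etrans ef e1)).
have eg := gact_gen g f; pose i := cast_ord ed (gidx g).
have [di|nd] := boolP (desc w^-1%g i); last first.
  apply: (lspanE (w := (sY i * w)%g)); rewrite -gact_wmor // -eg ef.
  by [].
(* As [i] is a left descent, [wmor w] itself begins with the generator [i]; composing with it once
   more gives a square, which is 0. *)
have nd : ~~ desc (sY i * w)^-1%g i by rewrite invMg sV desc_s di.
have := gact_wmor nd; rewrite sK => ew.
have [b [d' [f' [e1 e2]]]] := wmor_size (sY i * w)%g.
have id' : (i < (size d').-1)%N by rewrite e2 ltn_ord.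
have [e' e0] := gact_nil f' id'.
rewrite (@Arrow0 _ _ _ b e' (comp (lncmor g) f)); first exact: lspan0.
by rewrite -eg ef -ew e1 -e0.
Qed.

Lemma lspan_term d e (t : term (@lncgen n) d e) (f : @hom L c d) :
  lspanned f -> lspanned (comp (cls (@lncrel n) t : @hom L d e) f).
Proof.
elim: t f => {d e} [d e g|d|d1 d2 d3 t IHt u IHu|d e|d e t IHt u IHu|d e t IHt] f sf.
- exact: lspan_gen.
- by rewrite (lincat_comp1m HL).
- have -> : cls (@lncrel n) (TComp t u) =
      comp (cls (@lncrel n) t : @hom L d2 d3) (cls (@lncrel n) u : @hom L d1 d2).
    exact/esym/cls_comp.
  by rewrite -(lincat_compA HL); apply/IHt/IHu.
- have -> : cls (@lncrel n) (TZero (gen := @lncgen n) d e) = 0 by [].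
  by rewrite (lincat_comp0l HL); apply: lspan0.
- rewrite -addcls (lincat_compDl HL); apply: lspanD; [exact: IHt|exact: IHu].
- have -> : cls (@lncrel n) (TOpp t) = - (cls (@lncrel n) t : @hom L d e).
    exact/esym/cls_opp.
  by rewrite (lincat_compNl HL); apply/lspanN/IHt.
Qed.

Lemma lspan_all d (f : @hom L c d) : lspanned f.
Proof.
rewrite -(lincat_compm1 HL f) -(repK f); apply: lspan_term.
apply: (lspanE (w := 1%g)); rewrite -[1%g](wprod_nil (X := Yk)) -wmor_word //.
by rewrite wprod_nil len1.
Qed.

(** The target of [wmor w] depends on [w]; sending the elements with another target to 0 allows sums
    over the whole group. *)
Definition tohom d (a : arrow L) : @hom L c d :=
  if pselect (exists f, Arrow f = a) is left e then sval (cid e) else 0.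

Lemma tohomK d (f : @hom L c d) : tohom d (Arrow f) = f.
Proof.
rewrite /tohom; case: pselect => [e|[]]; last by exists f.
by case: cid => g /= /Arrow_inj.
Qed.

Lemma hom_sum d (f : @hom L c d) :
  exists a : Yk -> int, f = \sum_w tohom d (wmor w) *~ a w.
Proof.
elim: (lspan_all f) => [|f1 f2 _ [a1 e1] _ [a2 e2]|w {}f e].
- by exists (fun=> 0); rewrite big1 // => w _; rewrite mulr0z.
- exists (fun w => a1 w - a2 w); rewrite e1 e2 -sumrB; apply: eq_bigr => w _.
  by rewrite mulrzBr.
exists (fun w' => (w' == w)%:R); rewrite (bigD1 w) //= big1 ?addr0.
  by rewrite eqxx mulr1z -e tohomK.
by move=> w' /negbTE->; rewrite mulr0z.
Qed.

End Span.
End Words.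

(** * Faithfulness and fullness of the functor *)

Section Main.
Context {n : nat} (X : sysB n) (Y : forall k, sysB k).
Local Notation s := (@gen n X).
Local Notation A := (ADcat s).
Local Notation L := (LNCB n).
Local Notation bas := (@bas n X).
Local Notation psi := (psi X Y).
Implicit Types (c d e : lncob n).

Lemma psi_wmor c d (f : @hom L c d) (w : Y (size c).-1) :
    Arrow f = wmor w ->
  exists2 x : X, infl (set_of d) (set_of c) (wact w) x &
    subval (fmap psi f) = bas (set_of d) (set_of c) x.
Proof.
(* The identity is treated apart, since [is_word] covers nonempty words. *)
rewrite /wmor; have [e1 e2] := redwordP w; case eq: (redword _ w) => [|i q] e.
  have ed := Arrow_tgt e; subst d; move/Arrow_inj: e => ->.
  exists 1%g; last by rewrite fmap1.
  have -> : wact w = id by apply/funext => y; rewrite -e2 eq wprod_nil wact1.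
  exact: infl1.
have [|e' [_ [t wt]]] := @word_ex n (map val (i :: q)) c _ isT erefl.
  by apply/allP => m /mapP[j _ ->]; apply: ltn_ord.
rewrite (gact_word _ wt) in e; have ed := Arrow_tgt e; subst e'.
have -> : f = cls (@lncrel n) t.
  by rewrite (Arrow_inj e) (lincat_compm1 (presented_is_lincat (@lncrel n))).
have [q' [x [eq' _ ix ei]]] := word_interp X Y wt erefl.
have {}eq' : q' = i :: q by apply: (inj_map val_inj).
exists x; first by rewrite -e2 eq -eq'.
transitivity (subval (interp X t)).
  by congr subval; apply: (psi_cls X Y t).
by rewrite ei eq' -eq e2 e1 eqxx.
Qed.

Lemma psi_inj c d : injective (@fmap _ _ psi c d).
Proof.
suff H (f : @hom L c d) : fmap psi f = 0 -> f = 0.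
  move=> f g e; apply/eqP; rewrite -subr_eq0; apply/eqP/H.
  apply: (addIr (fmap psi g)).
  by rewrite -fmapD subrK add0r.
have [a ->] := hom_sum Y f; set m := tohom _ => H.
apply: big1 => w0 _; rewrite {}/m in H *.
rewrite /tohom; case: pselect => [ex0|_]; last by rewrite mul0rz.
suff -> : a w0 = 0 by rewrite mulr0z.
have [f0 ef0] := ex0; have [x0 i0 b0] := psi_wmor ef0.
(* The coefficient of the image at the coset of x0. It is 1 at w0 and 0 at any other element,
   because the coset determines its core representative and this determines the permutation of
   blocks. *)
pose ev (g : @hom L c d) : int :=
  (subval (fmap psi g) : {ffun dcos s (set_of d) (set_of c) -> int})
    (dcos_of s (set_of d) (set_of c) x0).
have evD g h : ev (g + h) = ev g + ev h by rewrite /ev fmapD /= ffunE.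
have ev0 : ev 0 = 0 by apply: (addrI (ev 0)); rewrite -evD !addr0.
have evN g : ev (- g) = - ev g.
  by apply/eqP; rewrite -addr_eq0 -evD addNr ev0.
have evn g (m : nat) : ev (g *+ m) = ev g * m%:Z.
  by elim: m => [|m IH]; rewrite ?ev0 ?mulr0 // mulrS evD IH intS mulrDr mulr1.
have evZ g (z : int) : ev (g *~ z) = ev g * z.
  by case: z => m; rewrite ?NegzE ?mulrNz ?evN -pmulrn evn ?mulrN.
have evb g (w : Y (size c).-1) : Arrow g = wmor w -> ev g = (w0 == w)%:R.
  move=> eg; have [x ix ex] := psi_wmor eg; rewrite /ev ex ffunE; congr (nat_of_bool _)%:R.
  apply/eqP/eqP => [/core_eq e|ew]; last first.
    by subst w; have [-> _] := infl_uniq (@wact_inj _ _ w0) i0 ix.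
  apply: wact_faithful; have e0 : x0 = x.
    by apply: e; [apply: infl_core i0|apply: infl_core ix]; apply: wact_inj.
  by rewrite e0 in i0; apply: infl_det i0 ix.
have : ev (\sum_w tohom c d (wmor w) *~ a w) = 0 by rewrite /ev H ffunE.
rewrite (big_morph ev evD ev0) (bigD1 w0) //= [X in _ + X]big1 ?addr0 => [|w nw].
  by rewrite evZ -ef0 tohomK (evb _ _ ef0) eqxx mul1r.
rewrite evZ; have [[f1 ef1]|nex] := pselect (exists f : @hom L c d, Arrow f = wmor w).
  by rewrite -ef1 tohomK (evb _ _ ef1) eq_sym (negbTE nw) mul0r.
by rewrite /tohom; case: pselect => // _; rewrite ev0 mul0r.
Qed.

(** Induction on how [g] is generated. The objects are kept general up to equality because a
    composite passes through an arbitrary subset [J], which is the image of [lncob_of J] by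
    [lncob_ofK]. *)
Lemma psi_surj c d (g : @hom A (set_of c) (set_of d)) :
  exists f : @hom L c d, fmap psi f = g.
Proof.
have [h hg] : exists h : @hom L c d, subval (fmap psi h) = subval g; last first.
  by exists h; apply: val_inj.
have H (J I : {set 'I_n}) (u : @hom (Dcat s) J I) : generated (@is_atomic X n s) u ->
    forall c d, set_of c = J -> set_of d = I -> exists h : @hom L c d,
    @Arrow (Dcat s) _ _ (subval (fmap psi h)) = Arrow u.
  elim=> {J I u c d g} [_ _ _ [J i] c d eJ eI|J c d eJ eJ'
    |K J I u v _ IHu _ IHv c e eK eI|J I c d eJ eI|J I u v _ IHu _ IHv c d eJ eI].
  - subst J; pose o := cast_ord (esym (card_eq c)) i.
    have ho : parts d == swap_parts o c.
      by rewrite -[parts d]class_sizes_set_of eI class_sizes_atarget class_sizes_set_of.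
    exists (lncmor (LncGen ho)); rewrite psi_gen avec_arrow; congr (Arrow (atomic _ _)).
    exact: val_inj.
  - subst J; have ed : c = d by apply: (can_inj set_ofK).
    by subst d; exists (idm (c : L)); rewrite fmap1.
  - have [h1 e1] := IHu (lncob_of J) e (lncob_ofK J) eI.
    have [h2 e2] := IHv c (lncob_of J) eK (lncob_ofK J).
    exists (comp h1 h2); rewrite fmapM.
    exact: (Arrow_comp e1 e2).
  - subst J I; exists 0; congr Arrow.
    have -> : fmap psi (0 : @hom L c d) = 0.
      by apply: (addrI (fmap psi 0)); rewrite -fmapD !addr0.
    by [].
  have [h1 e1] := IHu c d eJ eI; have [h2 e2] := IHv c d eJ eI.
  exists (h1 - h2); subst J I; congr Arrow.
  have -> : fmap psi (h1 - h2) = fmap psi h1 - fmap psi h2.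
    by apply: (addIr (fmap psi h2)); rewrite -fmapD !subrK.
  by rewrite -(Arrow_inj e1) -(Arrow_inj e2).
have [h e] := H _ _ _ (asboolW (subvalP g)) c d erefl erefl.
by exists h; apply: (Arrow_inj e).
Qed.

Lemma psi_iso : is_lincat_iso psi.
Proof.
exact: (@linfunctor_iso L A psi (@lncob_of n) (presented_is_lincat (@lncrel n))
  ADcat_is_lincat (@set_ofK n) (@lncob_ofK n) psi_inj psi_surj).
Qed.

End Main.

Theorem proposition4p9 (n : nat) :
  exists psi : linfunctor (LNCB n) (ADcat (@sB n)),
    [/\ forall c : lncob n, class_sizes (psi c) = parts c,
        forall (c d : lncob n) (g : lncgen c d),
          exists2 i : 'I_#|~: (psi c : {set 'I_n})|,
            gidx g = i :> nat &
            @Arrow (Dcat (@sB n)) _ _ (subval (fmap psi (lncmor g))) =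
            @Arrow (Dcat (@sB n)) _ _ (atomic (@sB n) i) &
        is_lincat_iso psi].
Proof.
exists (psi (WBsys n) WBsys); split.
- exact: class_sizes_set_of.
- move=> c d g; exists (aidx g) => //.
  by rewrite psi_gen; apply: (avec_arrow (WBsys n) g).
exact: (psi_iso (WBsys n) WBsys).
Qed.
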